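(* Consider the iterates of the EF-C-GT algorithm (defined in the context) applied to $f=\frac1n\sum_{i=1}^n f_i$, where the network, the weight matrix $W$, the functions $f_i$ and the (possibly biased, contractive) compression operator $\mathcal{C}$ with constant $\delta\in(0,1]$ satisfy the assumptions listed in the context. Let the scaling parameters satisfy $\alpha_x,\alpha_y\in(0,1]$. Let $\epsilon_1,\dots,\epsilon_7>0$ satisfy $$\epsilon_1\ge\frac{3\kappa^2}{n}\epsilon_2,\quad \epsilon_2\ge4d_1d_2\epsilon_4,\quad \epsilon_2\ge\frac{24d_1d_2\epsilon_6}{\delta},\quad \epsilon_3\ge\frac{4m_2'}{s},\quad \epsilon_6\ge\frac{8(1-\delta)\epsilon_4}{\delta^2},\quad \epsilon_7\ge\frac{8(1-\delta)\epsilon_5}{\delta^2},$$ let the consensus step-size $\gamma>0$ satisfy $$\gamma\le\min\Big\{1,\ \frac{1-d_x}{m_3'}\epsilon_4,\ \frac{1-d_y}{m_4'}\epsilon_5\Big\},$$ and let the fixed step-size $\eta>0$ satisfy $$\eta\le\min\Big\{\frac{s\epsilon_3}{6\kappa(2n\epsilon_1+2\epsilon_2+\epsilon_3)}\frac{\gamma}{L},\ \frac{s\epsilon_2}{4\kappa\epsilon_3}\frac{\gamma}{L},\ \frac{\delta}{2\mu}\Big\}.$$ Here $s,\kappa,d_1,d_2,d_x,d_y,m_2',m_3',m_4'$ and the $7\times 7$ matrix $B$ are defined in the context. Then the spectral radius of $B$ satisfies $\rho(B)\le1-\frac12\eta\mu$, and hence the optimization error $\Omega_o^k=\mathbb{E}\big[\|\overline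 X^k-x^*\|^2\big]$ and the consensus error $\Omega_c^k=\mathbb{E}\big[\|X^k-\mathbf 1\overline X^k\|^2\big]$ both converge to $0$ at the linear rate $\mathcal{O}\big((1-\frac12\eta\mu)^k\big)$.
   Context: Notation. $\|\cdot\|$ is the Frobenius norm for vectors and for $n\times p$ matrices and the spectral norm for square matrices; $\mathbf 1\in\mathbb{R}^n$ is the all-ones column vector. For $X\in\mathbb{R}^{n\times p}$ with rows $x_1^{\top},\dots,x_n^{\top}$ put $\overline X=\frac1n\mathbf 1^{\top}X\in\mathbb{R}^{1\times p}$ and $\nabla F(X)=[\nabla f_1(x_1),\dots,\nabla f_n(x_n)]^{\top}\in\mathbb{R}^{n\times p}$. Network. $n$ agents are connected by a strongly connected directed graph with a nonnegative doubly stochastic weight matrix $W=[w_{ij}]\in\mathbb{R}^{n\times n}$ ($W\mathbf 1=\mathbf 1$, $\mathbf 1^{\top}W=\mathbf 1^{\top}$), where agent $i$ can receive information from agent $j$ iff $w_{ij}>0$. Let $\rho_w$ be the spectral norm of $W-\frac1n\mathbf 1\mathbf 1^{\top}$; it holds that $\rho_w<1$. Put $s=1-\rho_w$ and $\tilde\rho=1-\gamma s$. Objective. $f_i:\mathbb{R}^p\to\mathbb{R}$ are differentiable, $f=\frac1n\sum_i f_i$ is $\mu$-strongly convex ($\langle\nabla f(x)-\nabla f(x'),x-x'\rangle\ge\mu\|x-x'\|^2$, $\mu>0$), and each $\nabla f_i$ is $L_i$-Lipschitz; $L=\max_i L_i$, $\kappa=L/\mu$. $x^*\in\mathbb{R}^{1\times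 p}$ is the unique minimizer of $f$ (as a row vector). Compression. The (possibly random) operator $\mathcal C:\mathbb{R}^p\to\mathbb{R}^p$ satisfies $\mathbb{E}\|\mathcal C(x)-x\|^2\le(1-\delta)\|x\|^2$ for all $x$, with a constant $\delta\in(0,1]$. $\mathrm{Compress}(Z)$ for $Z\in\mathbb{R}^{n\times p}$ applies $\mathcal C$ to each row of $Z$, with internal randomness drawn independently for each agent and at every iteration/call. EF-C-GT algorithm. Given initial values $X^0,H_x^0,H_y^0\in\mathbb{R}^{n\times p}$, $Y^0=\nabla F(X^0)$, $E_x^0=E_y^0=0$, for $k=0,1,2,\dots$: $Q_x^k=\mathrm{Compress}(X^k-H_x^k)$, $\widehat Q_x^k=\mathrm{Compress}(E_x^k+X^k-H_x^k)$, $E_x^{k+1}=E_x^k+X^k-H_x^k-\widehat Q_x^k$, $\widehat X^k=H_x^k+\widehat Q_x^k$, $H_x^{k+1}=H_x^k+\alpha_xQ_x^k$; $Q_y^k=\mathrm{Compress}(Y^k-H_y^k)$, $\widehat Q_y^k=\mathrm{Compress}(E_y^k+Y^k-H_y^k)$, $E_y^{k+1}=E_y^k+Y^k-H_y^k-\widehat Q_y^k$, $\widehat Y^k=H_y^k+\widehat Q_y^k$, $H_y^{k+1}=H_y^k+\alpha_yQ_y^k$; $X^{k+1}=X^k-\gamma(I-W)\widehat X^k-\eta Y^k$; $Y^{k+1}=Y^k-\gamma(I-W)\widehat Y^k+\nabla F(X^{k+1})-\nabla F(X^k)$. Constants. Fix $\tau_x',\tau_y'>1$ such that $d_x:=\tau_x'[\alpha_x(1-\delta)+(1-\alpha_x)]<1$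 and $d_y:=\tau_y'[\alpha_y(1-\delta)+(1-\alpha_y)]<1$, and put $t_x'=\frac{3\tau_x'}{\tau_x'-1}$, $t_y'=\frac{3\tau_y'}{\tau_y'-1}$, $d_1=\frac2s$, $d_2=\frac2s\|I-W\|^2$, $d_3=t_x'\|I-W\|^2$, $d_4=t_y'\|I-W\|^2$; $m_2'=3d_2\epsilon_2+3d_2\epsilon_4+d_2\epsilon_5+\frac{18d_2}{\delta}\epsilon_6+\frac{6d_2}{\delta}\epsilon_7$, $m_3'=2nt_x'\epsilon_1+2t_x'\epsilon_2+t_x'\epsilon_3+d_3\epsilon_2+d_3\epsilon_4+\frac{6d_3\epsilon_6}{\delta}+\frac{\epsilon_4}{2\kappa}$, $m_4'=6nt_y'\epsilon_1+6t_y'\epsilon_2+3t_y'\epsilon_3+3d_4\epsilon_2+d_4\epsilon_3+3d_4\epsilon_4+d_4\epsilon_5+\frac{18d_4}{\delta}\epsilon_6+\frac{6d_4}{\delta}\epsilon_7+\frac{\epsilon_5}{2\kappa}$. Matrix $B$ (the transition matrix of a component-wise linear inequality for the vector $[\Omega_o^k,\Omega_c^k,\Omega_g^k,\Omega_{cx}^k,\Omega_{cy}^k,\Omega_{ex}^k,\Omega_{ey}^k]^{\top}$, with $\Omega_o^k,\Omega_c^k$ as in the claim, $\Omega_g^k=\mathbb{E}\|Y^k-\mathbf 1\overline Y^k\|^2$, $\Omega_{cx}^k=\mathbb{E}\|X^k-H_x^k\|^2$, $\Omega_{cy}^k=\mathbb{E}\|Y^k-H_y^k\|^2$, $\Omega_{ex}^k=\mathbb{E}\|E_x^k\|^2$,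 $\Omega_{ey}^k=\mathbb{E}\|E_y^k\|^2$) has the following rows: row 1: $\big(1-\frac32\eta\mu,\ \frac{3\eta L^2}{\mu n},\ 0,\ 0,\ 0,\ 0,\ 0\big)$; row 2: $\big(0,\ \frac{1+\tilde\rho^2}{2},\ d_1\frac{\eta^2}{\gamma},\ d_2\gamma,\ 0,\ \frac{6d_2}{\delta}\gamma,\ 0\big)$; row 3: $\big(6nd_1L^4\frac{\eta^2}{\gamma},\ 3d_2L^2\gamma+6d_1L^4\frac{\eta^2}{\gamma},\ \frac{1+\tilde\rho^2}{2}+3d_1L^2\frac{\eta^2}{\gamma},\ 3d_2L^2\gamma,\ d_2\gamma,\ \frac{18d_2}{\delta}L^2\gamma,\ \frac{6d_2}{\delta}\gamma\big)$; row 4: $\big(2nt_x'L^2\eta^2,\ d_3\gamma^2+2t_x'L^2\eta^2,\ t_x'\eta^2,\ d_x+d_3\gamma^2,\ 0,\ \frac{6d_3}{\delta}\gamma^2,\ 0\big)$; row 5: $\big(6nt_y'L^4\eta^2,\ 3d_4L^2\gamma^2+6t_y'L^4\eta^2,\ 3t_y'L^2\eta^2+d_4\gamma^2,\ 3d_4L^2\gamma^2,\ d_y+d_4\gamma^2,\ \frac{18d_4}{\delta}L^2\gamma^2,\ \frac{6d_4}{\delta}\gamma^2\big)$; row 6: $\big(0,\ 0,\ 0,\ \frac{2(1-\delta)}{\delta},\ 0,\ 1-\frac\delta2,\ 0\big)$; row 7: $\big(0,\ 0,\ 0,\ 0,\ \frac{2(1-\delta)}{\delta},\ 0,\ 1-\frac\delta2\big)$.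 *)

(* Defs.v *)
From HB Require Import structures.
From mathcomp Require Import all_boot all_order all_algebra.
From mathcomp Require Import complex.
From mathcomp Require Import all_classical all_reals all_analysis.
Set Implicit Arguments.
Unset Strict Implicit.
Unset Printing Implicit Defensive.
Import Order.TTheory GRing.Theory Num.Theory.
Import numFieldNormedType.Exports.
Local Open Scope classical_set_scope.
Local Open Scope ring_scope.

(* Points of R^p are row vectors 'rV[R]_p; row i of an n x p matrix is the
   copy held by agent i. *)

Section linear_algebra.
Context {R : realType}.

(* The library norm `|A| of a matrix is the sup norm, so the Frobenius (for
   vectors: Euclidean) norm is introduced separately. *)
Definition frob m n (A : 'M[R]_(m, n)) : R :=
  Num.sqrt (\sum_i \sum_j A i j ^+ 2).

Definition dotv p (x y : 'rV[R]_p) : R := \sum_j x 0 j * y 0 j.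

(* Operator norm induced by the Euclidean norm. *)
Definition spectral_norm n (A : 'M[R]_n) : R :=
  sup [set frob (A *m v) | v in [set v : 'cV[R]_n | frob v <= 1]].

(* Supremum (a maximum, for n > 0) of the moduli of the complex eigenvalues. *)
Definition spectral_radius n (A : 'M[R]_n) : R :=
  sup [set ComplexField.Normc.normc l | l in
       [set l : R[i] | eigenvalue (map_mx (real_complex R) A) l]].

Definition mx_of_rows n (rows : seq (seq R)) : 'M[R]_n :=
  \matrix_(i < n, j < n) (nth [::] rows i)`_j.

Definition doubly_stochastic n (W : 'M[R]_n) : Prop :=
  [/\ forall i j, 0 <= W i j,
      W *m (const_mx 1 : 'cV[R]_n) = const_mx 1 &
      (const_mx 1 : 'rV[R]_n) *m W = const_mx 1].

(* There is an edge from j to i iff agent i receives information from j. *)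
Definition strongly_connected n (W : 'M[R]_n) : Prop :=
  forall i j, connect (fun j i : 'I_n => 0 < W i j) i j.

Definition row_mean n p (X : 'M[R]_(n, p)) : 'rV[R]_p :=
  n%:R^-1 *: ((const_mx 1 : 'rV[R]_n) *m X).

Definition consensus_part n p (X : 'M[R]_(n, p)) : 'M[R]_(n, p) :=
  (const_mx 1 : 'cV[R]_n) *m row_mean X.

End linear_algebra.

Section objective.
Context {R : realType} {p : nat}.

(* The vector of partial derivatives; for differentiable f it represents the
   differential of f. *)
Definition grad (f : 'rV[R]_p -> R) (x : 'rV[R]_p) : 'rV[R]_p :=
  \row_j 'D_(delta_mx 0 j) f x.

Definition strongly_convex (mu : R) (f : 'rV[R]_p -> R) : Prop :=
  forall x y, mu * frob (x - y) ^+ 2 <= dotv (grad f x - grad f y) (x - y).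

Definition lipschitz_grad (L : R) (f : 'rV[R]_p -> R) : Prop :=
  forall x y, frob (grad f x - grad f y) <= L * frob (x - y).

Definition unique_minimizer (f : 'rV[R]_p -> R) (x : 'rV[R]_p) : Prop :=
  unique (fun z => forall y, f z <= f y) x.

Definition average n (f : 'I_n -> 'rV[R]_p -> R) (x : 'rV[R]_p) : R :=
  n%:R^-1 * \sum_i f i x.

Definition stacked_grad n (f : 'I_n -> 'rV[R]_p -> R) (X : 'M[R]_(n, p)) :
    'M[R]_(n, p) :=
  \matrix_(i < n, j < p) grad (f i) (row i X) 0 j.

End objective.

Definition mean_square {d : measure_display} {T : measurableType d}
    {R : realType} (P : probability T R) m n (V : T -> 'M[R]_(m, n)) : \bar R :=
  'E_P[fun w => (frob (V w) ^+ 2)%R]%E.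

Section compression.
Context {R : realType} {p : nat} {dU : measure_display} {U : measurableType dU}.

(* A random operator on R^p is a map C : U -> R^p -> R^p together with a law
   nu on the space U of its internal randomness.  Joint measurability is what
   makes C u Z a random vector for a random seed u and a random vector Z; the
   sigma-algebra on R^p is the product one, which the library provides on
   p-tuples. *)
Definition measurable_operator (C : U -> 'rV[R]_p -> 'rV[R]_p) : Prop :=
  forall j : 'I_p, measurable_fun [set: U * p.-tuple (measurableTypeR R)]
    (fun z : U * p.-tuple (measurableTypeR R) =>
       C z.1 (\row_l tnth z.2 l) 0 j : measurableTypeR R).

Definition contractive (nu : probability U R) (C : U -> 'rV[R]_p -> 'rV[R]_p)
    (delta : R) : Prop :=
  forall x, (mean_square nu (fun u => C u x - x)%R <=
             ((1 - delta) * frob x ^+ 2)%:E)%E.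

End compression.

Definition compress {R : realType} {U : Type} n p
    (C : U -> 'rV[R]_p -> 'rV[R]_p) (u : 'I_n -> U) (Z : 'M[R]_(n, p)) :
    'M[R]_(n, p) :=
  \matrix_(i < n, j < p) C (u i) (row i Z) 0 j.

Definition mutually_independent {d dU : measure_display}
    {Omega : measurableType d} {U : measurableType dU} {R : realType}
    (P : probability Omega R) {I : Type} (xi : I -> Omega -> U) : Prop :=
  forall (m : nat) (J : 'I_m -> I) (A : 'I_m -> set U),
    injective J -> (forall k, measurable (A k)) ->
    P (\bigcap_(k in [set: 'I_m]) (xi (J k) @^-1` A k)) =
    (\prod_(k < m) P (xi (J k) @^-1` A k))%E.

(* The four compressions of one iteration, producing respectively
   Q_x, \widehat Q_x, Q_y and \widehat Q_y. *)
Inductive call := CallQx | CallQxhat | CallQy | CallQyhat.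

Section algorithm.
Context {R : realType} {n p : nat}.

Record state := State {
  st_X : 'M[R]_(n, p); st_Hx : 'M[R]_(n, p); st_Ex : 'M[R]_(n, p);
  st_Y : 'M[R]_(n, p); st_Hy : 'M[R]_(n, p); st_Ey : 'M[R]_(n, p) }.

Definition efcgt_step (W : 'M[R]_n) (f : 'I_n -> 'rV[R]_p -> R)
    (alphax alphay gamma eta : R) (cmp : call -> 'M[R]_(n, p) -> 'M[R]_(n, p))
    (st : state) : state :=
  let: State X Hx Ex Y Hy Ey := st in
  let Qx := cmp CallQx (X - Hx) in
  let Qxhat := cmp CallQxhat (Ex + X - Hx) in
  let Xhat := Hx + Qxhat in
  let Qy := cmp CallQy (Y - Hy) in
  let Qyhat := cmp CallQyhat (Ey + Y - Hy) in
  let Yhat := Hy + Qyhat in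
  let X' := X - gamma *: ((1%:M - W) *m Xhat) - eta *: Y in
  let Y' := Y - gamma *: ((1%:M - W) *m Yhat)
            + stacked_grad f X' - stacked_grad f X in
  {| st_X := X'; st_Hx := Hx + alphax *: Qx; st_Ex := Ex + X - Hx - Qxhat;
     st_Y := Y'; st_Hy := Hy + alphay *: Qy; st_Ey := Ey + Y - Hy - Qyhat |}.

(* Iterates for one realization u of the seeds: u (c, k, i) is used by agent i
   in the call c of iteration k. *)
Fixpoint efcgt {U : Type} (W : 'M[R]_n) (f : 'I_n -> 'rV[R]_p -> R)
    (C : U -> 'rV[R]_p -> 'rV[R]_p) (alphax alphay gamma eta : R)
    (X0 Hx0 Hy0 : 'M[R]_(n, p)) (u : call * nat * 'I_n -> U) (k : nat) : state :=
  match k with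
  | 0%N => {| st_X := X0; st_Hx := Hx0; st_Ex := 0;
              st_Y := stacked_grad f X0; st_Hy := Hy0; st_Ey := 0 |}
  | k'.+1 => efcgt_step W f alphax alphay gamma eta
               (fun c Z => compress C (fun i => u (c, k', i)) Z)
               (efcgt W f C alphax alphay gamma eta X0 Hx0 Hy0 u k')
  end.

End algorithm.

(* Main.v *)
Require Import Defs.
From HB Require Import structures.
From mathcomp Require Import all_boot all_order all_algebra complex ring lra.
From mathcomp Require Import all_classical all_reals all_analysis.
From mathcomp Require Import measurable_realfun.
Set Implicit Arguments.
Unset Strict Implicit.
Unset Printing Implicit Defensive.
Import Order.TTheory GRing.Theory Num.Theory.
Import numFieldNormedType.Exports.
Local Open Scope classical_set_scope.
Local Open Scope ring_scope.

(** The seven mean-square errors of the run (optimization, consensus, tracking,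
    two compression errors, two feedback memories) form a vector [v_k] with
    [v_{k+1} <= B v_k] componentwise, where [B] has nonnegative entries.  Both
    conclusions then follow from a single positive vector [w] such that
    [B w <= r w], with [r = 1 - eta mu / 2]:
    - pairing [w] with the moduli of a left eigenvector of [B] bounds every
      eigenvalue by [r] ([spectral_radius_le]);
    - if [v_0 <= K w], then [v_k <= K r^k w] for all [k] by induction.
    The vector is [w = (e1, e2, L^2 e3, e4, L^2 e5, e6, L^2 e7)], and the
    assumptions on the [e_i], [gamma] and [eta] are what the rows of [B w <= r w]
    ask for ([weight_row1] to [weight_row6]; the last two rows have the same
    shape).

    The inequality [v_{k+1} <= B v_k] ([mean_errors_step]) has a pathwise half and
    a probabilistic half.

    Pathwise, error feedback makes the transmitted matrix equal to
    [X^k + (E_x^k - E_x^{k+1})], so an iteration is an exact gossip step perturbed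
    by the variation of the feedback memory, and likewise for [Y].  Gossip
    contracts the disagreement by [1 - gamma s] and preserves column means
    ([disagreement_gossip_step], [mean_gossip_step]).  Hence the mean of [Y^k]
    remains the average of the local gradients, and the mean of [X^k] performs a
    gradient step on the average objective whose error is controlled by the
    disagreement ([optimization_error_step]).

    In the mean, the contraction of the compressor is available for deterministic
    arguments only, whereas it is applied to matrices produced by the run.  These
    are measurable functions of the earlier seeds ([measurable_run]), which are
    independent of the fresh ones ([independent_of_history]); so the joint law is
    a product, and Tonelli's theorem transfers the contraction to random arguments
    ([contractive_independent], [mean_le_compress]).  The compression errors,
    including the variation of the memory ([mean_feedback],
    [mean_feedback_variation]), follow from this and Young's inequality.

    All estimates in the mean go through the predicate [mean_le P g c], which
    bundles measurability, nonnegativity and the bound [E g <= c]; it is stable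
    under nonnegative combinations and domination, so that pathwise inequalities
    carry over and integrability never has to be discussed separately. *)

(** * Squared Frobenius norms and spectral norms *)

Lemma le_of_eq (disp : Order.disp_t) (T : porderType disp) (x y : T) :
  x = y -> (x <= y)%O.
Proof. by move=> ->. Qed.

Section frobenius.
Context {R : realType}.

Definition sqn m n (A : 'M[R]_(m, n)) : R := \sum_i \sum_j A i j ^+ 2.

Lemma sqn_ge0 m n (A : 'M[R]_(m, n)) : 0 <= sqn A.
Proof. by apply: sumr_ge0 => i _; apply: sumr_ge0 => j _; exact: sqr_ge0. Qed.

Lemma frob_sqr m n (A : 'M[R]_(m, n)) : frob A ^+ 2 = sqn A.
Proof. by rewrite /frob sqr_sqrtr // sqn_ge0. Qed.

Lemma frob_ge0 m n (A : 'M[R]_(m, n)) : 0 <= frob A.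
Proof. exact: sqrtr_ge0. Qed.

Lemma sqnZ m n a (A : 'M[R]_(m, n)) : sqn (a *: A) = a ^+ 2 * sqn A.
Proof.
rewrite /sqn mulr_sumr; apply: eq_bigr => i _; rewrite mulr_sumr.
by apply: eq_bigr => j _; rewrite mxE exprMn.
Qed.

Lemma sqnN m n (A : 'M[R]_(m, n)) : sqn (- A) = sqn A.
Proof. by rewrite -scaleN1r sqnZ sqrrN expr1n mul1r. Qed.

Lemma sqn0 m n : sqn (0 : 'M[R]_(m, n)) = 0.
Proof. by rewrite -(scale0r 0) sqnZ expr0n mul0r. Qed.

Lemma sqn_eq0 m n (A : 'M[R]_(m, n)) : sqn A = 0 -> A = 0.
Proof.
move=> /eqP; rewrite psumr_eq0 => [/allP h|i _]; last first.
  by apply: sumr_ge0 => j _; exact: sqr_ge0.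
apply/matrixP => i j; rewrite mxE; have /= := h i (mem_index_enum i).
rewrite psumr_eq0 => [/allP k|j' _]; last exact: sqr_ge0.
by have /= := k j (mem_index_enum j); rewrite sqrf_eq0 => /eqP.
Qed.

Lemma sqn_rows m n (A : 'M[R]_(m, n)) : sqn A = \sum_i sqn (row i A).
Proof.
apply: eq_bigr => i _; rewrite /sqn big_ord1.
by apply: eq_bigr => j _; rewrite mxE.
Qed.

Lemma sqn_cols m n (A : 'M[R]_(m, n)) : sqn A = \sum_j sqn (col j A).
Proof.
rewrite /sqn exchange_big; apply: eq_bigr => j _; apply: eq_bigr => i _.
by rewrite big_ord1 mxE.
Qed.

(** The general form of Young's inequality: the usual one-parameter family is
    [x = 1 + c], [y = 1 + 1 / c].  Allowing [>=] in the side condition leaves the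
    choice of both coefficients to the user. *)
Lemma young_scalar (a b x y : R) : 1 < x -> 1 <= (x - 1) * (y - 1) ->
  (a + b) ^+ 2 <= x * a ^+ 2 + y * b ^+ 2.
Proof.
move=> x1 xy; have x0 : 0 < x - 1 by rewrite subr_gt0.
rewrite -subr_ge0 -(pmulr_rge0 _ x0).
have -> : (x - 1) * (x * a ^+ 2 + y * b ^+ 2 - (a + b) ^+ 2) =
  ((x - 1) * a - b) ^+ 2 + ((x - 1) * (y - 1) - 1) * b ^+ 2 by ring.
by rewrite addr_ge0 ?sqr_ge0 // mulr_ge0 ?sqr_ge0 // subr_ge0.
Qed.

Lemma sqnD_le m n (A B : 'M[R]_(m, n)) x y : 1 < x -> 1 <= (x - 1) * (y - 1) ->
  sqn (A + B) <= x * sqn A + y * sqn B.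
Proof.
move=> x1 xy; rewrite /sqn !mulr_sumr -big_split /=; apply: ler_sum => i _.
rewrite !mulr_sumr -big_split /=; apply: ler_sum => j _; rewrite mxE.
exact: young_scalar.
Qed.

Lemma sqnD3_le m n (A B C : 'M[R]_(m, n)) :
  sqn (A + B + C) <= 3 * (sqn A + sqn B + sqn C).
Proof.
rewrite /sqn -!big_split /= mulr_sumr; apply: ler_sum => i _.
rewrite -!big_split /= mulr_sumr; apply: ler_sum => j _; rewrite !mxE.
set a := A i j; set b := B i j; set c := C i j.
rewrite -subr_ge0; have -> : 3 * (a ^+ 2 + b ^+ 2 + c ^+ 2) - (a + b + c) ^+ 2 =
  (a - b) ^+ 2 + (a - c) ^+ 2 + (b - c) ^+ 2 by ring.
by rewrite !addr_ge0 ?sqr_ge0.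
Qed.

Lemma sqn_convex m n (A B : 'M[R]_(m, n)) a : 0 <= a <= 1 ->
  sqn ((1 - a) *: A + a *: B) <= (1 - a) * sqn A + a * sqn B.
Proof.
move=> /andP[a0 a1]; rewrite /sqn !mulr_sumr -big_split /=; apply: ler_sum => i _.
rewrite !mulr_sumr -big_split /=; apply: ler_sum => j _; rewrite !mxE.
set u := A i j; set v := B i j; rewrite -subr_ge0.
have -> : (1 - a) * u ^+ 2 + a * v ^+ 2 - ((1 - a) * u + a * v) ^+ 2 =
  a * (1 - a) * (u - v) ^+ 2 by ring.
by rewrite mulr_ge0 ?sqr_ge0 ?mulr_ge0 ?subr_ge0.
Qed.

Lemma dotvC p (x y : 'rV[R]_p) : dotv x y = dotv y x.
Proof. by apply: eq_bigr => j _; rewrite mulrC. Qed.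

Lemma sqnD p (x y : 'rV[R]_p) : sqn (x + y) = sqn x + 2 * dotv x y + sqn y.
Proof.
rewrite /sqn !big_ord1 /dotv mulr_sumr -!big_split /=.
by apply: eq_bigr => j _; rewrite mxE; ring.
Qed.

Lemma dotvZr p a (x y : 'rV[R]_p) : dotv x (a *: y) = a * dotv x y.
Proof. by rewrite /dotv mulr_sumr; apply: eq_bigr => j _; rewrite mxE mulrCA. Qed.

Lemma dotv_le p (x y : 'rV[R]_p) : dotv x y <= frob x * frob y.
Proof.
have [x0|x0] := eqVneq (frob x) 0.
  have /sqn_eq0 E : sqn x = 0 by rewrite -frob_sqr x0 expr0n.
  by rewrite x0 mul0r E /dotv big1 // => j _; rewrite mxE mul0r.
have xp : 0 < frob x by rewrite lt_def x0 frob_ge0.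
have [y0|y0] := eqVneq (frob y) 0.
  have /sqn_eq0 E : sqn y = 0 by rewrite -frob_sqr y0 expr0n.
  by rewrite y0 mulr0 E /dotv big1 // => j _; rewrite mxE mulr0.
have yp : 0 < frob y by rewrite lt_def y0 frob_ge0.
have := sqn_ge0 (frob y *: x + - frob x *: y).
rewrite sqnD !sqnZ dotvZr dotvC dotvZr dotvC -!frob_sqr.
set a := frob x in xp *; set b := frob y in yp *; set t := dotv _ _ => h.
have ab : 0 < 2 * (a * b) by rewrite !mulr_gt0.
rewrite -subr_ge0 -(pmulr_rge0 _ ab); apply: le_trans h _.
by apply: le_of_eq; ring.
Qed.

Lemma frobZ m n a (A : 'M[R]_(m, n)) : frob (a *: A) = `|a| * frob A.
Proof.
apply/eqP; rewrite -(eqrXn2 (n := 2)) ?mulr_ge0 ?frob_ge0 //.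
by rewrite exprMn !frob_sqr sqnZ real_normK // num_real.
Qed.

Lemma frob_le m n (A : 'M[R]_(m, n)) c : 0 <= c -> sqn A <= c ^+ 2 -> frob A <= c.
Proof. by move=> c0 h; rewrite -(ler_pXn2r (n := 2)) ?nnegrE ?frob_ge0 // frob_sqr. Qed.

Lemma sqr_entry_le m n (A : 'M[R]_(m, n)) i j : A i j ^+ 2 <= sqn A.
Proof.
rewrite /sqn (bigD1 i) //= (bigD1 j) //= -addrA lerDl addr_ge0 //.
  by apply: sumr_ge0 => k _; exact: sqr_ge0.
by apply: sumr_ge0 => k _; apply: sumr_ge0 => l _; exact: sqr_ge0.
Qed.

Lemma sqn_mulmx_le m n p (A : 'M[R]_(m, n)) (B : 'M[R]_(n, p)) :
  sqn (A *m B) <= sqn A * sqn B.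
Proof.
rewrite (sqn_rows A) (sqn_cols B) mulr_suml; apply: ler_sum => i _.
rewrite mulr_sumr; apply: ler_sum => j _; rewrite mxE.
have -> : \sum_k A i k * B k j = dotv (row i A) (col j B)^T.
  by apply: eq_bigr => k _; rewrite !mxE.
have -> : sqn (col j B) = sqn (col j B)^T.
  by rewrite /sqn exchange_big; apply: eq_bigr => k _; apply: eq_bigr => l _; rewrite !mxE.
rewrite -!frob_sqr -exprMn -ler_sqrt ?sqr_ge0 // !sqrtr_sqr.
rewrite [`|_ * _|]ger0_norm ?mulr_ge0 ?frob_ge0 // ler_norml dotv_le andbT.
rewrite lerNl -mulN1r -dotvZr scaleN1r; apply: le_trans (dotv_le _ _) _.
by rewrite -scaleN1r frobZ normrN1 mul1r.
Qed.

Section spectral.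
Variables (n : nat) (A : 'M[R]_n).

(** The supremum defining the spectral norm is finite since the Frobenius norm
    of [A] is an upper bound, by Cauchy-Schwarz. *)
Lemma frob_mul_spectral_ub (v : 'cV[R]_n) : frob v <= 1 ->
  frob (A *m v) <= spectral_norm A.
Proof.
move=> v1; apply: ub_le_sup; last by exists v.
exists (frob A) => _ [u /= u1 <-]; apply: frob_le; first exact: frob_ge0.
apply: le_trans (sqn_mulmx_le _ _) _; rewrite frob_sqr ler_piMr ?sqn_ge0 //.
by rewrite -frob_sqr expr_le1 // frob_ge0.
Qed.

Lemma spectral_norm_ge0 : 0 <= spectral_norm A.
Proof.
apply: le_trans (@frob_mul_spectral_ub 0 _); first exact: frob_ge0.
by apply: frob_le; rewrite ?ler01 // sqn0 expr1n ler01.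
Qed.

(** The operator norm acts on each column separately, so its bound extends from
    vectors to matrices under the Frobenius norm. *)
Lemma sqn_mul_spectral p (B : 'M[R]_(n, p)) :
  sqn (A *m B) <= spectral_norm A ^+ 2 * sqn B.
Proof.
rewrite (sqn_cols (A *m B)) (sqn_cols B) mulr_sumr; apply: ler_sum => j _.
have -> : col j (A *m B) = A *m col j B.
  by apply/colP => i; rewrite !mxE; apply: eq_bigr => k _; rewrite mxE.
set v := col j B.
have [v0|v0] := eqVneq (frob v) 0.
  have /sqn_eq0 -> : sqn v = 0 by rewrite -frob_sqr v0 expr0n.
  by rewrite mulmx0 sqn0 mulr0.
have vp : 0 < frob v by rewrite lt_def v0 frob_ge0.
rewrite -!frob_sqr -exprMn ler_pXn2r ?nnegrE ?mulr_ge0 ?frob_ge0 ?spectral_norm_ge0 //.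
have := @frob_mul_spectral_ub ((frob v)^-1 *: v).
rewrite -scalemxAr !frobZ ger0_norm ?invr_ge0 ?frob_ge0 // mulVf // => /(_ (lexx _)).
by rewrite mulrC ler_pdivrMr.
Qed.

End spectral.

Lemma sqn_mxvec m n (A : 'M[R]_(m, n)) : sqn (mxvec A) = sqn A.
Proof.
rewrite /sqn big_ord1 pair_bigA /= (reindex _ (curry_mxvec_bij m n)) /=.
by apply: eq_bigr => -[i j] _; rewrite mxvecE.
Qed.

Lemma frobD m n (A B : 'M[R]_(m, n)) : frob (A + B) <= frob A + frob B.
Proof.
apply: frob_le; first by rewrite addr_ge0 ?frob_ge0.
rewrite -sqn_mxvec raddfD sqnD !sqn_mxvec sqrrD !frob_sqr lerD2r lerD2l.
rewrite -[leRHS]mulr_natl ler_pM2l //.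
apply: le_trans (dotv_le _ _) _.
by rewrite /frob -!/(sqn _) !sqn_mxvec.
Qed.

End frobenius.

(** * Averaging and gossip *)

Section averaging.
Context {R : realType} {n : nat}.
Hypothesis n_gt0 : (0 < n)%N.

Let nR_neq0 : n%:R != 0 :> R. Proof. by rewrite pnatr_eq0 -lt0n. Qed.

Lemma row_meanE p (X : 'M[R]_(n, p)) j : row_mean X 0 j = n%:R^-1 * \sum_i X i j.
Proof.
by rewrite /row_mean !mxE; congr (_ * _); apply: eq_bigr => i _; rewrite mxE mul1r.
Qed.

Lemma consensus_partE p (X : 'M[R]_(n, p)) i j :
  consensus_part X i j = row_mean X 0 j.
Proof. by rewrite /consensus_part mxE big_ord1 mxE mul1r. Qed.

Lemma disagreementE p (X : 'M[R]_(n, p)) i j :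
  (X - consensus_part X) i j = X i j - row_mean X 0 j.
Proof. by rewrite mxE [X in _ + X]mxE consensus_partE. Qed.

(** Pythagoras: the constant-column part and the disagreement are orthogonal. *)
Lemma sqn_consensus_split p (X : 'M[R]_(n, p)) :
  sqn X = sqn (X - consensus_part X) + n%:R * sqn (row_mean X).
Proof.
rewrite /sqn big_ord1 mulr_sumr exchange_big /= [X in _ = X + _]exchange_big /=.
rewrite -big_split /=; apply: eq_bigr => j _.
under [X in _ = X + _]eq_bigr => i _ do rewrite disagreementE.
set m := row_mean X 0 j.
have hm : \sum_i X i j = n%:R * m by rewrite /m row_meanE mulrA mulfV // mul1r.
have -> : \sum_i (X i j - m) ^+ 2 =
    \sum_i X i j ^+ 2 - (2 * m) * \sum_i X i j + n%:R * m ^+ 2.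
  have -> : n%:R * m ^+ 2 = \sum_(i < n) m ^+ 2 by rewrite sumr_const card_ord mulr_natl.
  rewrite mulr_sumr -sumrB -big_split /=.
  by apply: eq_bigr => i _; ring.
by rewrite hm; ring.
Qed.

Lemma sqn_disagreement_le p (X : 'M[R]_(n, p)) : sqn (X - consensus_part X) <= sqn X.
Proof. by rewrite [leRHS]sqn_consensus_split lerDl mulr_ge0 ?sqn_ge0. Qed.

Section gossip.
Variables (W : 'M[R]_n) (gamma : R).
Hypothesis hW : doubly_stochastic W.
Local Notation J := (n%:R^-1 *: const_mx 1 : 'M[R]_n).
Local Notation rho := (spectral_norm (W - J)).
Local Notation nIW := (spectral_norm (1%:M - W)).

Let ones_sqr : (const_mx 1 : 'cV[R]_n) *m (const_mx 1 : 'rV[R]_n) = const_mx 1.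
Proof. by apply/matrixP => i j; rewrite !mxE big_ord1 !mxE mulr1. Qed.

Lemma consensus_part_mul p (X : 'M[R]_(n, p)) : consensus_part X = J *m X.
Proof.
by rewrite /consensus_part /row_mean -ones_sqr -scalemxAr mulmxA -scalemxAl.
Qed.

Lemma mean_gossip_eq0 p (X : 'M[R]_(n, p)) : row_mean ((1%:M - W) *m X) = 0.
Proof.
by rewrite /row_mean mulmxA mulmxBr mulmx1; case: hW => _ _ ->; rewrite subrr mul0mx scaler0.
Qed.

Lemma consensus_gossip_eq0 p (X : 'M[R]_(n, p)) : consensus_part ((1%:M - W) *m X) = 0.
Proof. by rewrite /consensus_part mean_gossip_eq0 mulmx0. Qed.

Lemma gossip_consensus_eq0 p (X : 'M[R]_(n, p)) : (1%:M - W) *m consensus_part X = 0.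
Proof.
by rewrite /consensus_part mulmxA mulmxBl mul1mx; case: hW => _ -> _; rewrite subrr mul0mx.
Qed.

Lemma consensus_part_idem p (X : 'M[R]_(n, p)) :
  consensus_part (consensus_part X) = consensus_part X.
Proof.
apply/matrixP => i j; rewrite !consensus_partE row_meanE.
under eq_bigr => k _ do rewrite consensus_partE.
by rewrite sumr_const card_ord -[X in _ * X]mulr_natl mulrA mulVf ?mul1r.
Qed.

Lemma row_meanD p (X Y : 'M[R]_(n, p)) : row_mean (X + Y) = row_mean X + row_mean Y.
Proof. by rewrite /row_mean mulmxDr scalerDr. Qed.

Lemma row_meanZ p a (X : 'M[R]_(n, p)) : row_mean (a *: X) = a *: row_mean X.
Proof. by rewrite /row_mean -scalemxAr !scalerA mulrC. Qed.

Lemma row_meanN p (X : 'M[R]_(n, p)) : row_mean (- X) = - row_mean X.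
Proof. by rewrite -scaleN1r row_meanZ scaleN1r. Qed.

Lemma consensus_partD p (X Y : 'M[R]_(n, p)) :
  consensus_part (X + Y) = consensus_part X + consensus_part Y.
Proof. by rewrite /consensus_part row_meanD mulmxDr. Qed.

Lemma consensus_partZ p a (X : 'M[R]_(n, p)) :
  consensus_part (a *: X) = a *: consensus_part X.
Proof. by rewrite /consensus_part row_meanZ -scalemxAr. Qed.

Lemma consensus_partN p (X : 'M[R]_(n, p)) : consensus_part (- X) = - consensus_part X.
Proof. by rewrite -scaleN1r consensus_partZ scaleN1r. Qed.

Hypothesis hgamma : 0 < gamma <= 1.
Hypothesis hrho : rho < 1.
Local Notation s := (1 - rho).

(** On a matrix without consensus part, [W] acts as [W - J], where [J] is the
    averaging matrix; a lazy gossip step is thus the convex combination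
    [(1 - gamma) V + gamma (W - J) V]. *)
Lemma gossip_contraction p (V : 'M[R]_(n, p)) : consensus_part V = 0 ->
  frob (V - gamma *: ((1%:M - W) *m V)) <= (1 - gamma * s) * frob V.
Proof.
rewrite consensus_part_mul => JV.
have -> : V - gamma *: ((1%:M - W) *m V) = (1 - gamma) *: V + gamma *: ((W - J) *m V).
  rewrite !mulmxBl mul1mx JV subr0 scalerBr scalerBl scale1r opprB addrA.
  by rewrite addrAC.
case/andP: (hgamma) => g0 g1.
apply: le_trans (frobD _ _) _; rewrite !frobZ !ger0_norm ?subr_ge0 ?(ltW g0) //.
have h : frob ((W - J) *m V) <= rho * frob V.
  apply: frob_le; first by rewrite mulr_ge0 ?frob_ge0 // spectral_norm_ge0.
  by rewrite exprMn frob_sqr sqn_mul_spectral.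
have -> : (1 - gamma * s) * frob V = (1 - gamma) * frob V + gamma * (rho * frob V).
  by ring.
by rewrite lerD2l ler_pM2l.
Qed.

(** Young's inequality with the weights for which the factor [(1 - sigma)^2]
    becomes its midpoint with 1.  This form, where [sigma] times the gap is
    [(1 - sigma) (sigma g - b)^2 + sigma^3 g^2 / 2], also covers [sigma = 1]. *)
Lemma contraction_young (g b sigma : R) : 0 < sigma <= 1 ->
  ((1 - sigma) * g + b) ^+ 2 <=
  (1 + (1 - sigma) ^+ 2) / 2 * g ^+ 2 + sigma^-1 * b ^+ 2.
Proof.
move=> /andP[s0 s1]; rewrite -subr_ge0 -(pmulr_rge0 _ s0).
have -> : sigma * ((1 + (1 - sigma) ^+ 2) / 2 * g ^+ 2 + sigma^-1 * b ^+ 2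
            - ((1 - sigma) * g + b) ^+ 2) =
  (1 - sigma) * (sigma * g - b) ^+ 2 + sigma ^+ 3 / 2 * g ^+ 2.
  by field; rewrite gt_eqF.
rewrite addr_ge0 // mulr_ge0 ?sqr_ge0 ?subr_ge0 // divr_ge0 // exprn_ge0 //.
exact: ltW.
Qed.

Variables (p : nat) (Z Zh D : 'M[R]_(n, p)).
Local Notation Z' := (Z - gamma *: ((1%:M - W) *m Zh) + D).

Let sqn_gossip (V : 'M[R]_(n, p)) :
  sqn (- (gamma *: ((1%:M - W) *m V))) <= gamma ^+ 2 * nIW ^+ 2 * sqn V.
Proof. by rewrite sqnN sqnZ -mulrA ler_wpM2l ?sqr_ge0 // sqn_mul_spectral. Qed.

(** An inexact gossip step, using [Zh] in place of [Z], with an additional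
    displacement [D].  This covers both updates of the algorithm: [D] is
    [- eta Y] for [X], and the variation of the local gradients for [Y]. *)
Lemma disagreement_gossip_step :
  sqn (Z' - consensus_part Z') <=
  (1 + (1 - gamma * s) ^+ 2) / 2 * sqn (Z - consensus_part Z)
  + (gamma * s)^-1 * (2 * (gamma ^+ 2 * nIW ^+ 2 * sqn (Zh - Z)
                           + sqn (D - consensus_part D))).
Proof.
case/andP: (hgamma) => g0 g1.
have s0 : 0 < s by rewrite subr_gt0.
have s1 : s <= 1 by rewrite lerBlDr lerDl spectral_norm_ge0.
have gs : 0 < gamma * s <= 1 by rewrite mulr_gt0 //= mulr_ile1 // ltW.
set V := Z - consensus_part Z.
pose G := V - gamma *: ((1%:M - W) *m V).
pose b := - (gamma *: ((1%:M - W) *m (Zh - Z))) + (D - consensus_part D).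
(* [I - W] kills the consensus part on either side, so that only the
   disagreement of [Z] enters the exact part [G]. *)
have -> : Z' - consensus_part Z' = G + b.
  rewrite !consensus_partD !consensus_partN consensus_partZ consensus_gossip_eq0.
  rewrite /G /b /V scaler0 subr0 !mulmxBr gossip_consensus_eq0 subr0 !scalerBr.
  apply/matrixP => i j; rewrite !mxE; ring.
rewrite -frob_sqr; apply: (@le_trans _ _ (((1 - gamma * s) * frob V + frob b) ^+ 2)).
  rewrite ler_pXn2r ?nnegrE ?addr_ge0 ?mulr_ge0 ?frob_ge0 ?subr_ge0 //; last first.
    by case/andP: gs.
  apply: le_trans (frobD _ _) _; rewrite lerD2r; apply: gossip_contraction.
  by rewrite consensus_partD consensus_partN consensus_part_idem subrr.
apply: le_trans (contraction_young _ _ gs) _.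
rewrite !frob_sqr lerD2l ler_pM2l ?invr_gt0; last by case/andP: gs.
have /le_trans -> // : sqn b <= 2 * sqn (- (gamma *: ((1%:M - W) *m (Zh - Z))))
    + 2 * sqn (D - consensus_part D).
  by apply: sqnD_le; lra.
by rewrite mulrDr lerD2r ler_pM2l // sqn_gossip.
Qed.

Lemma gossip_increment :
  sqn (Z' - Z) <= 3 * (gamma ^+ 2 * nIW ^+ 2 * sqn (Zh - Z)
    + gamma ^+ 2 * nIW ^+ 2 * sqn (Z - consensus_part Z) + sqn D).
Proof.
have -> : Z' - Z = - (gamma *: ((1%:M - W) *m (Zh - Z)))
    + - (gamma *: ((1%:M - W) *m (Z - consensus_part Z))) + D.
  rewrite !mulmxBr gossip_consensus_eq0 subr0 scalerBr.
  by apply/matrixP => i j; rewrite !mxE; ring.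
by apply: le_trans (sqnD3_le _ _ _) _; rewrite ler_pM2l // lerD2r lerD // sqn_gossip.
Qed.

Lemma mean_gossip_step : row_mean Z' = row_mean Z + row_mean D.
Proof.
by rewrite !row_meanD row_meanN row_meanZ mean_gossip_eq0 scaler0 subr0.
Qed.

End gossip.
End averaging.

(** * Gradients of the local and the average objective *)

Section gradients.
Context {R : realType} {p : nat}.

Lemma difference_quotient_line (g : 'rV[R]_p -> R) (a v : 'rV[R]_p) (t : R) :
  (fun h : R => h^-1 *: (((fun s : R => g (a + s *: v)) \o shift t) (h *: (1 : R))
                          - g (a + t *: v)))
  = (fun h : R => h^-1 *: ((g \o shift (a + t *: v)) (h *: v) - g (a + t *: v))).
Proof.
apply/funext => h /=; congr (_ *: (g _ - _)).
have -> : h *: (1 : R) = h by exact: mulr1.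
by rewrite scalerDl addrCA.
Qed.

(** Each partial derivative is the derivative of the restriction to a line, which
    has a minimum at the origin of that line. *)
Lemma grad_minimizer (g : 'rV[R]_p -> R) (x : 'rV[R]_p) :
  (forall y, differentiable g y) -> (forall y, g x <= g y) -> grad g x = 0.
Proof.
move=> dg gx; apply/rowP => j; rewrite !mxE; set v := delta_mx 0 j.
pose h (s : R) := g (x + s *: v).
have dh t : derivable h t 1.
  rewrite /derivable /h difference_quotient_line.
  exact: (diff_derivable (v := v) (dg (x + t *: v))).
have /(_ 0) := @derive1_at_min R h (-1) 1 _ _ (fun t _ => dh t).
case; first lra.
- by rewrite in_itv /= ltr01 ltrN10.
- by move=> t _; rewrite /h scale0r addr0 gx.
move=> _ <-; rewrite /derive /h difference_quotient_line.
by rewrite scale0r addr0.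
Qed.

Lemma grad_average n (f : 'I_n -> 'rV[R]_p -> R) (x : 'rV[R]_p) :
  (forall i y, differentiable (f i) y) ->
  grad (average f) x = n%:R^-1 *: \sum_i grad (f i) x.
Proof.
move=> df; apply/rowP => j; rewrite !mxE summxE.
have dfx i : derivable (f i) x (delta_mx 0 j) by apply: diff_derivable.
have -> : average f = n%:R^-1 \*: (\sum_i f i).
  by apply/funext => y; rewrite /average fct_sumE.
rewrite deriveZ; last exact: derivable_sum.
rewrite derive_sum //; congr (_ * _).
by apply: eq_bigr => i _; rewrite mxE.
Qed.

End gradients.

Section objective.
Context {R : realType} {n p : nat}.
Hypothesis n_gt0 : (0 < n)%N.
Variables (f : 'I_n -> 'rV[R]_p -> R) (L mu : R) (xs : 'rV[R]_p).
Hypothesis f_diff : forall i x, differentiable (f i) x.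
Hypothesis f_lip : forall i, lipschitz_grad L (f i).
Hypothesis L_ge0 : 0 <= L.

Let nR_gt0 : 0 < n%:R :> R. Proof. by rewrite ltr0n. Qed.

Lemma sqn_stacked_grad_le (X Y : 'M[R]_(n, p)) :
  sqn (stacked_grad f X - stacked_grad f Y) <= L ^+ 2 * sqn (X - Y).
Proof.
rewrite (sqn_rows (_ - stacked_grad _ _)) (sqn_rows (X - Y)) mulr_sumr.
apply: ler_sum => i _; rewrite -!frob_sqr -exprMn.
rewrite ler_pXn2r ?nnegrE ?mulr_ge0 ?frob_ge0 // !linearB /=.
have rowE Z : row i (stacked_grad f Z) = grad (f i) (row i Z).
  by apply/rowP => j; rewrite !mxE.
by rewrite !rowE f_lip.
Qed.

Lemma mean_stacked_grad_const (x : 'rV[R]_p) :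
  row_mean (stacked_grad f ((const_mx 1 : 'cV[R]_n) *m x)) = grad (average f) x.
Proof.
rewrite grad_average //; apply/rowP => j; rewrite row_meanE mxE summxE.
congr (_ * _); apply: eq_bigr => i _; rewrite mxE; congr (grad _ _ _ _).
by apply/rowP => k; rewrite !mxE big_ord1 !mxE mul1r.
Qed.

Lemma sqn_row_mean_le (X : 'M[R]_(n, p)) : n%:R * sqn (row_mean X) <= sqn X.
Proof. by rewrite [leRHS]sqn_consensus_split // lerDr sqn_ge0. Qed.

Lemma sqn_grad_average_le (x y : 'rV[R]_p) :
  sqn (grad (average f) x - grad (average f) y) <= L ^+ 2 * sqn (x - y).
Proof.
rewrite -!mean_stacked_grad_const -row_meanN -row_meanD -(ler_pM2l nR_gt0).
apply: le_trans (sqn_row_mean_le _) _; apply: le_trans (sqn_stacked_grad_le _ _) _.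
rewrite -mulmxBr mulrCA ler_wpM2l ?sqr_ge0 // sqn_rows.
rewrite (eq_bigr (fun=> sqn (x - y))) => [|i _].
  by rewrite sumr_const card_ord mulr_natl.
by congr sqn; apply/rowP => k; rewrite !mxE big_ord1 !mxE mul1r.
Qed.

(** The mean of the local gradients, each taken at its own point, is close to the
    gradient of the average objective at the mean point: compare [X] with its
    consensus part, at which the two coincide. *)
Lemma sqn_mean_grad_deviation (X : 'M[R]_(n, p)) :
  n%:R * sqn (row_mean (stacked_grad f X) - grad (average f) (row_mean X)) <=
  L ^+ 2 * sqn (X - consensus_part X).
Proof.
rewrite -mean_stacked_grad_const -row_meanN -row_meanD.
by apply: le_trans (sqn_row_mean_le _) _; exact: sqn_stacked_grad_le.
Qed.

Hypothesis f_convex : strongly_convex mu (average f).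
Hypothesis mu_gt0 : 0 < mu.

(** Compare the two moduli on one pair of distinct points, which exists because
    the dimension is positive. *)
Lemma strong_convexity_le_lipschitz : (0 < p)%N -> mu <= L.
Proof.
move=> p0; pose x : 'rV[R]_p := delta_mx 0 (Ordinal p0).
have x1 : frob x = 1.
  rewrite /frob big_ord1 (bigD1 (Ordinal p0)) //= big1 => [|j /negbTE jn].
    by rewrite mxE !eqxx addr0 expr1n sqrtr1.
  by rewrite mxE jn andbF expr0n.
have := f_convex x 0; rewrite subr0 x1 expr1n mulr1 => /le_trans -> //.
apply: le_trans (dotv_le _ _) _; rewrite x1 mulr1; apply: frob_le => //.
by apply: le_trans (sqn_grad_average_le _ _) _; rewrite subr0 -frob_sqr x1 expr1n mulr1.
Qed.

Hypothesis xs_min : forall y, average f xs <= average f y.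

Lemma grad_average_minimizer : grad (average f) xs = 0.
Proof.
apply: grad_minimizer => // y.
have -> : average f = n%:R^-1 \*: (\sum_i f i).
  by apply/funext => z; rewrite /average fct_sumE.
by apply: differentiableZ; apply: differentiable_sum.
Qed.

(** Beyond its disagreement, [Y] consists of its mean, an approximation of the
    gradient at the mean point; the latter is small near the minimizer. *)
Lemma sqn_tracking_le (X Y : 'M[R]_(n, p)) :
  row_mean Y = row_mean (stacked_grad f X) ->
  sqn Y <= sqn (Y - consensus_part Y) + 2 * n%:R * L ^+ 2 * sqn (row_mean X - xs)
           + 2 * L ^+ 2 * sqn (X - consensus_part X).
Proof.
move=> hY; rewrite [leLHS]sqn_consensus_split // -addrA lerD2l hY.
set g := grad (average f) (row_mean X).
have -> : row_mean (stacked_grad f X) = (row_mean (stacked_grad f X) - g) + g.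
  by rewrite subrK.
have h : sqn (row_mean (stacked_grad f X) - g + g) <=
    2 * sqn (row_mean (stacked_grad f X) - g) + 2 * sqn g by apply: sqnD_le; lra.
apply: le_trans (ler_wpM2l (ltW nR_gt0) h) _.
have h1 := sqn_mean_grad_deviation X; rewrite -/g in h1.
have h2 : n%:R * sqn g <= n%:R * (L ^+ 2 * sqn (row_mean X - xs)).
  rewrite ler_pM2l //; have := sqn_grad_average_le (row_mean X) xs.
  by rewrite grad_average_minimizer subr0.
lra.
Qed.

(** An inexact gradient step.  The step-size condition absorbs the quadratic term
    [eta^2 |grad|^2] into one sixth of [eta mu], so that strong monotonicity and
    the Lipschitz bound alone give the factor [1 - 11 t / 6] for the exact step,
    where [t = eta mu].  The Young coefficients [3 / (3 - t)] and [3 / t] turn it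
    into [1 - 3 t / 2] and give the second coefficient exactly. *)
Lemma optimization_error_step (eta : R) (X : 'M[R]_(n, p)) :
  0 < eta -> mu <= L -> 6 * (eta * L ^+ 2) <= mu ->
  sqn (row_mean X - eta *: row_mean (stacked_grad f X) - xs) <=
  (1 - 3 / 2 * eta * mu) * sqn (row_mean X - xs)
  + 3 * eta * L ^+ 2 / (mu * n%:R) * sqn (X - consensus_part X).
Proof.
move=> eta0 muL etaL; set x := row_mean X; set G := row_mean _.
set g := grad (average f) x; set t := eta * mu.
have t0 : 0 < t by rewrite mulr_gt0.
have t1 : t <= 6^-1.
  rewrite -(ler_pM2l (x := mu)) // /t.
  have : eta * mu ^+ 2 <= eta * L ^+ 2.
    by rewrite ler_pM2l // ler_pXn2r ?nnegrE // ltW.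
  by rewrite expr2; lra.
have -> : x - eta *: G - xs = (x - xs - eta *: g) + - eta *: (G - g).
  by apply/rowP => j; rewrite !mxE; ring.
have t3 : 0 < 3 - t by lra.
apply: le_trans (@sqnD_le _ _ _ _ _ (3 / (3 - t)) (3 / t) _ _) _.
- by rewrite ltr_pdivlMr //; lra.
- apply: le_of_eq; field.
  by rewrite !gt_eqF.
apply: lerD; last first.
  rewrite sqnZ sqrrN; have h := sqn_mean_grad_deviation X; rewrite -/g -/x -/G in h.
  have -> : 3 / t * (eta ^+ 2 * sqn (G - g)) =
      3 * eta / (mu * n%:R) * (n%:R * sqn (G - g)).
    by rewrite /t; field; rewrite !gt_eqF.
  have -> : 3 * eta * L ^+ 2 / (mu * n%:R) * sqn (X - consensus_part X) =
      3 * eta / (mu * n%:R) * (L ^+ 2 * sqn (X - consensus_part X)) by ring.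
  by rewrite ler_wpM2l // divr_ge0 ?mulr_ge0 // ltW.
have hA : sqn (x - xs - eta *: g) <= (1 - 11 / 6 * t) * sqn (x - xs).
  rewrite -[- (eta *: g)]scaleNr sqnD dotvZr sqnZ sqrrN dotvC.
  have := f_convex x xs; rewrite grad_average_minimizer subr0 frob_sqr -/g => h1.
  have := sqn_grad_average_le x xs; rewrite grad_average_minimizer subr0 -/g => h2.
  have h3 : eta * (mu * sqn (x - xs)) <= eta * dotv g (x - xs) by rewrite ler_pM2l.
  have h4 : eta ^+ 2 * sqn g <= eta ^+ 2 * (L ^+ 2 * sqn (x - xs)).
    by rewrite ler_wpM2l // sqr_ge0.
  have h5 : (eta * (6 * (eta * L ^+ 2))) * sqn (x - xs) <= (eta * mu) * sqn (x - xs).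
    by rewrite ler_wpM2r ?sqn_ge0 // ler_pM2l.
  rewrite -/t in h5; have : eta ^+ 2 * L ^+ 2 = eta * (eta * L ^+ 2) by ring.
  rewrite /t in h5 *; lra.
apply: (@le_trans _ _ (3 / (3 - t) * ((1 - 11 / 6 * t) * sqn (x - xs)))).
  by rewrite ler_wpM2l // divr_ge0 // ltW.
rewrite mulrA ler_wpM2r ?sqn_ge0 //.
have -> : 1 - 3 / 2 * eta * mu = 1 - 3 / 2 * t by rewrite /t mulrA.
rewrite mulrAC ler_pdivrMr // -subr_ge0.
have -> : (1 - 3 / 2 * t) * (3 - t) - 3 * (1 - 11 / 6 * t) = 3 / 2 * t ^+ 2 by field.
by rewrite mulr_ge0 // sqr_ge0.
Qed.

End objective.

(** * Upper bounds on expectations *)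

Section mean_bounds.
Context {d : measure_display} {T : measurableType d} {R : realType}.
Variable P : probability T R.

Definition mean_le (g : T -> R) (c : R) : Prop :=
  [/\ measurable_fun setT g, forall w, 0 <= g w & ('E_P[g] <= c%:E)%E].

Lemma mean_leD g h a b :
  mean_le g a -> mean_le h b -> mean_le (fun w => g w + h w) (a + b).
Proof.
move=> [mg g0 ga] [mh h0 hb]; split => [|w|]; first exact: measurable_funD.
  exact: addr_ge0.
rewrite unlock in ga hb *; rewrite EFinD.
under eq_integral => w _ do rewrite EFinD.
rewrite ge0_integralD //; first exact: leeD.
- by move=> w _; rewrite lee_fin.
- exact/measurable_EFinP.
- by move=> w _; rewrite lee_fin.
- exact/measurable_EFinP.
Qed.

Lemma mean_leZ k g a : 0 <= k -> mean_le g a -> mean_le (fun w => k * g w) (k * a).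
Proof.
move=> k0 [mg g0 ga]; split => [|w|]; first exact: measurable_funM.
  exact: mulr_ge0.
rewrite unlock in ga *; under eq_integral => w _ do rewrite EFinM.
rewrite ge0_integralZl_EFin //; first by rewrite EFinM; exact: lee_wpmul2l.
- by move=> w _; rewrite lee_fin.
- exact/measurable_EFinP.
Qed.

Lemma mean_le_trans (g h : T -> R) a b : measurable_fun setT g -> (forall w, 0 <= g w) ->
  (forall w, g w <= h w) -> mean_le h a -> a <= b -> mean_le g b.
Proof.
move=> mg g0 gh [mh h0 ha] ab; split => //.
apply: (@le_trans _ _ ('E_P[h])%E); last by apply: le_trans ha _; rewrite lee_fin.
by apply: expectation_le => //; exact/aeW.
Qed.

Lemma mean_le_mono (g : T -> R) a b : mean_le g a -> a <= b -> mean_le g b.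
Proof. by move=> [mg g0 h] ab; split => //; apply: le_trans h _; rewrite lee_fin. Qed.

Lemma mean_le_cst (a b : R) : 0 <= a -> a <= b -> mean_le (fun=> a) b.
Proof.
move=> a0 ab; split => //.
by rewrite expectation_cst lee_fin.
Qed.

Lemma mean_le_ge0 (g : T -> R) c : mean_le g c -> 0 <= c.
Proof.
by move=> [_ g0 gc]; rewrite -lee_fin; apply: le_trans gc; exact: expectation_ge0.
Qed.

End mean_bounds.

(** * Measurability of the operations of the algorithm *)

Section measurable_matrices.
Context {d : measure_display} {T : measurableType d} {R : realType}.

(** Entrywise, this is measurability for the product sigma-algebra. *)
Definition measurable_mx m n (V : T -> 'M[R]_(m, n)) : Prop :=
  forall i j, measurable_fun setT (fun w => V w i j).

Lemma measurable_mx_cst m n (A : 'M[R]_(m, n)) : measurable_mx (fun=> A).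
Proof. by move=> i j; exact: measurable_cst. Qed.

Lemma measurable_mxD m n (V V' : T -> 'M[R]_(m, n)) :
  measurable_mx V -> measurable_mx V' -> measurable_mx (fun w => V w + V' w).
Proof.
by move=> h h' i j; under eq_fun do rewrite mxE; exact: measurable_funD.
Qed.

Lemma measurable_mxZ m n a (V : T -> 'M[R]_(m, n)) :
  measurable_mx V -> measurable_mx (fun w => a *: V w).
Proof.
by move=> h i j; under eq_fun do rewrite mxE; exact: measurable_funM.
Qed.

Lemma measurable_mxB m n (V V' : T -> 'M[R]_(m, n)) :
  measurable_mx V -> measurable_mx V' -> measurable_mx (fun w => V w - V' w).
Proof.
by move=> h h'; under eq_fun do rewrite -scaleN1r; apply: measurable_mxD => //;
  exact: measurable_mxZ.
Qed.

Lemma measurable_mx_mull m n p (A : 'M[R]_(m, n)) (V : T -> 'M[R]_(n, p)) :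
  measurable_mx V -> measurable_mx (fun w => A *m V w).
Proof.
move=> h i j; under eq_fun do rewrite mxE.
by apply: measurable_sum => k; exact: measurable_funM.
Qed.

Lemma measurable_mx_row m n i (V : T -> 'M[R]_(m, n)) :
  measurable_mx V -> measurable_mx (fun w => row i (V w)).
Proof. by move=> h k j; under eq_fun do rewrite mxE; exact: h. Qed.

Lemma measurable_row_mean n p (V : T -> 'M[R]_(n, p)) :
  measurable_mx V -> measurable_mx (fun w => row_mean (V w)).
Proof. by move=> h; apply: measurable_mxZ; exact: measurable_mx_mull. Qed.

Lemma measurable_consensus_part n p (V : T -> 'M[R]_(n, p)) :
  measurable_mx V -> measurable_mx (fun w => consensus_part (V w)).
Proof. by move=> h; apply: measurable_mx_mull; exact: measurable_row_mean. Qed.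

Lemma measurable_sqn m n (V : T -> 'M[R]_(m, n)) :
  measurable_mx V -> measurable_fun setT (fun w => sqn (V w)).
Proof.
move=> h; apply: measurable_sum => i; apply: measurable_sum => j.
exact: measurable_funX.
Qed.

Lemma rational_approx p (x : 'rV[R]_p) (e : R) : 0 < e ->
  exists q : 'rV[rat]_p, frob (x - map_mx ratr q) <= e.
Proof.
move=> e0; have p0 : 0 < (p.+1)%:R :> R by rewrite ltr0n.
have /choice[q hq] : forall j : 'I_p, exists q : rat, `|x 0 j - ratr q| <= e / (p.+1)%:R.
  move=> j; have : x 0 j < x 0 j + e / p.+1%:R by rewrite ltrDl divr_gt0.
  move=> /rat_in_itvoo[q]; rewrite in_itv /= => /andP[h1 h2]; exists q.
  by rewrite ltr0_norm ?subr_lt0 // opprB lerBlDl ltW.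
exists (\row_j q j); apply: frob_le; first exact: ltW.
rewrite /sqn big_ord1; apply: (@le_trans _ _ (\sum_(j < p) (e / p.+1%:R) ^+ 2)).
  apply: ler_sum => j _; rewrite !mxE -[leLHS]real_normK ?num_real //.
  by rewrite ler_pXn2r ?nnegrE // ltW // divr_gt0.
rewrite sumr_const card_ord -[leLHS]mulr_natl expr_div_n mulrCA ler_piMr ?sqr_ge0 //.
rewrite ler_pdivrMr ?exprn_gt0 // mul1r expr2.
apply: (@le_trans _ _ p.+1%:R); first by rewrite ler_nat.
by rewrite ler_pMr // ler1n.
Qed.

(** A Lipschitz function is the supremum over rational points [q] of the functions
    [g q - K |x - q|], so its strict superlevel sets are countable unions of
    measurable sets. *)
Lemma measurable_lipschitz p (g : 'rV[R]_p -> R) (K : R) (V : T -> 'rV[R]_p) :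
  (forall x y, `|g x - g y| <= K * frob (x - y)) -> measurable_mx V ->
  measurable_fun setT (fun w => g (V w)).
Proof.
move=> lip mV.
apply: (measurability _ (RGenOInfty.measurableE R)) => _ [_ [a ->] <-].
pose H (q : 'rV[rat]_p) :=
  [set w | a < g (map_mx ratr q) - K * frob (V w - map_mx ratr q)].
have -> : setT `&` (fun w => g (V w)) @^-1` `]a, +oo[ = \bigcup_q H q.
  apply/seteqP; split => w /=; rewrite in_itv /= andbT; last first.
    move=> [q _] /lt_le_trans -> //; have := lip (V w) (map_mx ratr q).
    by rewrite ler_norml => /andP[h _]; lra.
  move=> [_ ag]; have K1 : 0 < 2 * `|K| + 1 by have := normr_ge0 K; lra.
  have e0 : 0 < (g (V w) - a) / (2 * `|K| + 1).
    by rewrite divr_gt0 // subr_gt0.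
  have [q hq] := rational_approx (V w) e0; exists q => //; rewrite /H /=.
  have := lip (V w) (map_mx ratr q); rewrite ler_norml => /andP[_].
  set F := frob _ in hq *; have F0 : 0 <= F := frob_ge0 _.
  rewrite ler_pdivlMr // in hq.
  have : K * F <= `|K| * F by rewrite ler_wpM2r // ler_norm.
  have [F00|F00] := eqVneq F 0; first by rewrite F00 !mulr0; lra.
  have : 0 < F by rewrite lt_def F00.
  lra.
apply: countable_bigcupT_measurable => [|q]; first exact: countableP.
rewrite /H -[X in measurable X]setTI.
apply: (measurable_fun_ltr (f := fun=> a)
  (g := fun w => g (map_mx ratr q) - K * frob (V w - map_mx ratr q))) => //.
apply: measurable_funB => //; apply: measurable_funM => //.
rewrite (_ : (fun w => _) = Num.sqrt \o (fun w => sqn (V w - map_mx ratr q))) //.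
apply: measurableT_comp; first apply: continuous_measurable_fun => x.
  exact: (@realfun.sqrt_continuous R x).
by apply: measurable_sqn; apply: measurable_mxB => //; exact: measurable_mx_cst.
Qed.

Lemma measurable_stacked_grad n p (f : 'I_n -> 'rV[R]_p -> R) (L : R)
    (V : T -> 'M[R]_(n, p)) :
  (forall i, lipschitz_grad L (f i)) -> measurable_mx V ->
  measurable_mx (fun w => stacked_grad f (V w)).
Proof.
move=> f_lip mV i j; under eq_fun do rewrite mxE.
apply: (@measurable_lipschitz _ (fun x => grad (f i) x 0 j) L) => [x y|].
  apply: le_trans (f_lip i x y).
  have -> : grad (f i) x 0 j - grad (f i) y 0 j = (grad (f i) x - grad (f i) y) 0 j.
    by rewrite !mxE.
  rewrite -(ler_pXn2r (n := 2)) ?nnegrE ?frob_ge0 // frob_sqr real_normK ?num_real //.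
  exact: sqr_entry_le.
exact: measurable_mx_row.
Qed.

Context {p : nat} {dU : measure_display} {U : measurableType dU}.
Variable C : U -> 'rV[R]_p -> 'rV[R]_p.
Hypothesis C_meas : measurable_operator C.

Lemma measurable_compress n (u : 'I_n -> T -> U) (V : T -> 'M[R]_(n, p)) :
  (forall i, measurable_fun setT (u i)) -> measurable_mx V ->
  measurable_mx (fun w => compress C (u ^~ w) (V w)).
Proof.
move=> mu mV i j; under eq_fun do rewrite mxE.
have -> : (fun w => C (u i w) (row i (V w)) 0 j) =
    (fun z : U * p.-tuple (measurableTypeR R) => C z.1 (\row_l tnth z.2 l) 0 j)
    \o (fun w => (u i w, [tuple V w i l | l < p])).
  apply/funext => w /=; congr (C _ _ _ _).
  by apply/rowP => l; rewrite !mxE tnth_mktuple.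
apply: measurableT_comp; first exact: C_meas.
apply: measurable_fun_pair => //; apply/measurable_fun_tnthP => l.
by rewrite /comp; under eq_fun do rewrite tnth_mktuple; exact: mV.
Qed.

End measurable_matrices.

(** * Contraction of the compressor at independent random arguments *)

Section independence.
Context {d dU : measure_display} {Omega : measurableType d}
  {U : measurableType dU} {R : realType}.
Variable P : probability Omega R.

Definition independent_of (G : set (set Omega)) (v : Omega -> U) : Prop :=
  forall D B, G D -> measurable B ->
  P (D `&` v @^-1` B) = (P D * P (v @^-1` B))%E.

(** For fixed [B], the two sides are finite measures in [D] that agree on a
    pi-system containing the whole space. *)
Lemma independent_of_sigma (G : set (set Omega)) (v : {RV P >-> U}) :
  G `<=` measurable -> setI_closed G -> G setT ->
  independent_of G v -> independent_of <<s G >> v.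
Proof.
move=> Gm GI GT ind D B sD mB.
have mvB : measurable (v @^-1` B) by exact: measurable_funPTI.
have PB0 : 0 <= fine (P (v @^-1` B)) by rewrite fine_ge0.
pose r : {nonneg R} := NngNum PB0.
have PBE : P (v @^-1` B) = r%:num%:E.
  by rewrite /= fineK // fin_num_measure.
rewrite muleC PBE -[LHS]/(mrestr P mvB D) -[RHS]/(mscale r P D).
apply: (g_sigma_algebra_measure_unique G Gm (fun=> setT)) => //.
- by apply/seteqP; split => // w _; exists 0%N.
- by move=> A GA; rewrite /= /mrestr /mscale ind // muleC PBE.
- move=> k /=; rewrite /mrestr.
  by apply: le_lt_trans (probability_le1 P _) _; rewrite ?ltry //; exact: measurableI.
Qed.

Lemma measurable_fun_coarser (d' : measure_display) (S : measurableType d')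
    (G G' : set (set Omega)) (g : Omega -> S) : G `<=` <<s G' >> ->
  measurable_fun (setT : set (g_sigma_algebraType G)) g ->
  measurable_fun (setT : set (g_sigma_algebraType G')) g.
Proof.
move=> GG' mg _ B mB; have := mg measurableT B mB; apply: smallest_sub => //.
exact: smallest_sigma_algebra.
Qed.

Lemma measurable_fun_sub_sigma (d' : measure_display) (S : measurableType d')
    (G : set (set Omega)) (g : Omega -> S) : G `<=` measurable ->
  measurable_fun (setT : set (g_sigma_algebraType G)) g ->
  measurable_fun (setT : set Omega) g.
Proof.
move=> Gm mg _ B mB; have := mg measurableT B mB; apply: smallest_sub => //.
exact: sigma_algebra_measurable.
Qed.

Context {p : nat}.
Variables (nu : probability U R) (C : U -> 'rV[R]_p -> 'rV[R]_p) (delta : R).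
Hypothesis delta_le1 : delta <= 1.
Hypothesis C_meas : measurable_operator C.
Hypothesis C_contr : contractive nu C delta.
Variable G : set (set Omega).
Hypothesis G_meas : G `<=` measurable.
Hypothesis G_setI : setI_closed G.
Hypothesis G_setT : G setT.

(** By independence, the joint law of the seed [v] and the argument [z] is the
    product of [nu] and the law of [z].  Integrating over the seed first, with the
    argument fixed, is the contraction hypothesis. *)
Lemma contractive_independent (v : {RV P >-> U}) (z : Omega -> 'rV[R]_p) :
  (forall B, measurable B -> P (v @^-1` B) = nu B) -> independent_of G v ->
  measurable_mx (z : g_sigma_algebraType G -> 'rV[R]_p) ->
  ('E_P[fun w => sqn (C (v w) (z w) - z w)] <= (1 - delta)%:E * 'E_P[fun w => sqn (z w)])%E.
Proof.
move=> v_law v_ind mz.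
pose TT : measurableType _ := p.-tuple (measurableTypeR R).
(* The argument is carried as a tuple, the form for which [C] is assumed to be
   jointly measurable. *)
pose zt (w : Omega) : TT := [tuple z w 0 l | l < p].
pose vec (t : TT) : 'rV[R]_p := \row_l tnth t l.
have zvec w : vec (zt w) = z w by apply/rowP => l; rewrite mxE tnth_mktuple.
have mztG : measurable_fun (setT : set (g_sigma_algebraType G)) zt.
  apply/measurable_fun_tnthP => l.
  by rewrite /comp; under eq_fun do rewrite tnth_mktuple; exact: mz.
have mzt : measurable_fun setT zt by exact: measurable_fun_sub_sigma mztG.
pose Z : {RV P >-> TT} := HB.pack zt (isMeasurableFun.Build _ _ _ _ _ mzt).
have mpair : measurable_fun setT (fun w => (v w, zt w)).
  exact: measurable_fun_pair.
pose VZ : {RV P >-> (U * TT)%type} :=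
  HB.pack (fun w => (v w, zt w)) (isMeasurableFun.Build _ _ _ _ _ mpair).
have law : forall A : set (U * TT), measurable A ->
    (nu \x distribution P Z)%E A = distribution P VZ A.
  apply: product_measure_unique => A B mA mB.
  transitivity (P (zt @^-1` B `&` v @^-1` A)).
    by rewrite setIC.
  rewrite (independent_of_sigma G_meas G_setI G_setT v_ind) //; last first.
    by have := mztG measurableT B mB; rewrite setTI.
  by rewrite muleC v_law.
have mvec (S : measurableType _) (t : S -> TT) : measurable_fun setT t ->
    measurable_mx (fun w => vec (t w)).
  move=> mt i l; under eq_fun do rewrite mxE.
  exact: (measurableT_comp (@measurable_tnth _ (measurableTypeR R) p l) mt).
pose h (y : U * TT) : R := sqn (C y.1 (vec y.2) - vec y.2).
have mh : measurable_fun setT h.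
  apply: measurable_sqn; apply: measurable_mxB; last exact: mvec.
  by move=> i j; rewrite ord1; exact: C_meas.
pose k (y : TT) : R := sqn (vec y).
have mk : measurable_fun setT k by apply: measurable_sqn; exact: mvec.
have -> : ('E_P[fun w => sqn (C (v w) (z w) - z w)] =
    \int[distribution P VZ]_y (h y)%:E)%E.
  rewrite ge0_integral_distribution; last by move=> y; rewrite lee_fin sqn_ge0.
    by rewrite unlock; apply: eq_integral => w _ /=; rewrite /h /= zvec.
  exact/measurable_EFinP.
have -> : ('E_P[fun w => sqn (z w)] = \int[distribution P Z]_y (k y)%:E)%E.
  rewrite ge0_integral_distribution; last by move=> y; rewrite lee_fin sqn_ge0.
    by rewrite unlock; apply: eq_integral => w _ /=; rewrite /k /= zvec.
  exact/measurable_EFinP.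
rewrite -(@eq_measure_integral _ _ _ _ _ (nu \x distribution P Z)%E); last first.
  by move=> A mA _; exact: law.
have mhE : measurable_fun setT (EFin \o h) by exact/measurable_EFinP.
rewrite (fubini_tonelli2 (EFin \o h)) //; last by move=> y; rewrite lee_fin sqn_ge0.
have mkE : measurable_fun setT (EFin \o k) by exact/measurable_EFinP.
rewrite -ge0_integralZl_EFin ?subr_ge0 //; last by move=> y _; rewrite lee_fin sqn_ge0.
apply: ge0_le_integral => //.
- by move=> y _; apply: integral_ge0 => u _; rewrite lee_fin sqn_ge0.
- apply: measurable_fun_fubini_tonelli_G => // y; rewrite lee_fin; exact: sqn_ge0.
- by apply: emeasurable_funM => //; exact: measurable_cst.
move=> y _; have := C_contr (vec y); rewrite /mean_square unlock frob_sqr -EFinM.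
apply: le_trans; apply: le_of_eq.
by apply: eq_integral => u _; rewrite frob_sqr.
Qed.

Lemma mean_le_compress n (v : 'I_n -> {RV P >-> U}) (Z : Omega -> 'M[R]_(n, p)) c :
  (forall i B, measurable B -> P (v i @^-1` B) = nu B) ->
  (forall i, independent_of G (v i)) ->
  measurable_mx (Z : g_sigma_algebraType G -> 'M[R]_(n, p)) ->
  mean_le P (fun w => sqn (Z w)) c ->
  mean_le P (fun w => sqn (compress C (fun i => v i w) (Z w) - Z w)) ((1 - delta) * c).
Proof.
move=> v_law v_ind mZG [_ _ hc].
have mZ : measurable_mx Z by move=> i j; exact: measurable_fun_sub_sigma (mZG i j).
have mvZ : measurable_mx (fun w => compress C (fun i => v i w) (Z w) - Z w).
  by apply: measurable_mxB => //; apply: measurable_compress.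
split; [exact: measurable_sqn|by move=> w; exact: sqn_ge0|].
have sumE (V : Omega -> 'M[R]_(n, p)) : measurable_mx V ->
    ('E_P[fun w => sqn (V w)] = \sum_i 'E_P[fun w => sqn (row i (V w))])%E.
  move=> mV; rewrite unlock; under eq_integral => w _ do rewrite sqn_rows -sumEFin.
  rewrite ge0_integral_sum // => [i|i w _]; last by rewrite lee_fin sqn_ge0.
  by apply/measurable_EFinP/measurable_sqn; exact: measurable_mx_row.
rewrite sumE // EFinM; apply: (@le_trans _ _ ((1 - delta)%:E * 'E_P[fun w => sqn (Z w)])%E).
  rewrite (sumE _ mZ) ge0_sume_distrr; last first.
    by move=> i _; apply: expectation_ge0 => w; exact: sqn_ge0.
  apply: lee_sum => i _.
  have -> : (fun w => sqn (row i (compress C (fun i => v i w) (Z w) - Z w))) =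
      (fun w => sqn (C (v i w) (row i (Z w)) - row i (Z w))).
    by apply/funext => w; congr sqn; apply/rowP => j; rewrite !mxE.
  apply: contractive_independent; [exact: v_law|exact: v_ind|].
  exact: (@measurable_mx_row _ (g_sigma_algebraType G) R n p i Z mZG).
by apply: lee_wpmul2l => //; rewrite lee_fin subr_ge0.
Qed.

End independence.

(** * The history of the run *)

Section history.
Context {d dU : measure_display} {Omega : measurableType d}
  {U : measurableType dU} {R : realType} {n : nat}.
Variable P : probability Omega R.
Variable xi : call * nat * 'I_n -> {RV P >-> U}.

(** The cylinder events of the seeds used before iteration [k].  They form a
    pi-system, which generates the sigma-algebra of the past. *)
Definition history (k : nat) : set (set Omega) :=
  [set D | exists2 A : call * nat * 'I_n -> set U, (forall t, measurable (A t)) &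
     D = [set w | forall t, (t.1.2 < k)%N -> A t (xi t w)]].

Definition call_of (a b : bool) : call :=
  if a then (if b then CallQx else CallQxhat) else (if b then CallQy else CallQyhat).

(** An enumeration, without repetition, of the finitely many seeds used before
    iteration [k]: this is the shape in which independence is assumed. *)
Definition past_index k (i : 'I_#|{: bool * bool * 'I_k * 'I_n}|) :
    call * nat * 'I_n :=
  let x := enum_val i in (call_of x.1.1.1 x.1.1.2, x.1.2 : nat, x.2).

Lemma past_index_inj k : injective (@past_index k).
Proof.
move=> i j; rewrite /past_index => -[e1 e2 e3]; apply: enum_val_inj.
case: (enum_val i) (enum_val j) e1 e2 e3 => [[[a b] l] s] [[[a' b'] l'] s'] /=.
by move=> e1 /val_inj -> ->; case: a b a' b' e1 => [] [] [] [].
Qed.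

Lemma past_index_lt k (i : 'I_#|{: bool * bool * 'I_k * 'I_n}|) :
  ((past_index i).1.2 < k)%N.
Proof. exact: ltn_ord. Qed.

Lemma past_index_surj k t : (t.1.2 < k)%N -> exists i, @past_index k i = t.
Proof.
case: t => [[c l] s] /= lk; have [a [b <-]] : exists a b, call_of a b = c.
  by case: c; [exists true, true|exists true, false|exists false, true|exists false, false].
exists (enum_rank (a, b, Ordinal lk, s)).
by rewrite /past_index enum_rankK.
Qed.

Lemma historyE k (A : call * nat * 'I_n -> set U) :
  [set w | forall t, (t.1.2 < k)%N -> A t (xi t w)] =
  \bigcap_(i in [set: 'I_#|{: bool * bool * 'I_k * 'I_n}|])
     (xi (past_index i) @^-1` A (past_index i)).
Proof.
apply/seteqP; split => w h; first by move=> i _; exact/h/past_index_lt.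
by move=> t /past_index_surj [i <-]; exact: (h i).
Qed.

Lemma history_measurable k : history k `<=` measurable.
Proof.
move=> _ [A mA ->]; rewrite historyE; apply: fin_bigcap_measurable => // i _.
exact: measurable_funPTI.
Qed.

Lemma history_setI k : setI_closed (history k).
Proof.
move=> _ _ [A mA ->] [A' mA' ->]; exists (fun t => A t `&` A' t).
  by move=> t; exact: measurableI.
apply/seteqP; split => [w [h h'] t tk|w h]; first by split; [exact: h|exact: h'].
by split => t /h [].
Qed.

Lemma history_setT k : history k setT.
Proof. by exists (fun=> setT) => //; apply/seteqP; split. Qed.

Lemma history_sub k : history k `<=` <<s history k.+1 >>.
Proof.
move=> _ [A mA ->]; apply: sub_sigma_algebra.
exists (fun t => if (t.1.2 < k)%N then A t else setT).
  by move=> t; case: ifP.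
apply/seteqP; split => w h t; last first.
  by move=> tk; have := h t (leqW tk); rewrite tk.
by case: ifP => // tk _; exact: h.
Qed.

Lemma seed_history k t : (t.1.2 < k)%N ->
  measurable_fun (setT : set (g_sigma_algebraType (history k))) (xi t).
Proof.
move=> tk _ B mB; rewrite setTI; apply: sub_sigma_algebra.
exists (fun t' => if `[< t' = t >] then B else setT).
  by move=> t'; case: ifP.
apply/seteqP; split => w /=.
  by move=> h t' _; case: asboolP => // ->.
by move=> /(_ t tk); case: asboolP.
Qed.

Hypothesis xi_indep : mutually_independent P (fun t => xi t : Omega -> U).

(** Apply the product rule to the family of all past seeds, and again to this
    family with the seed [t] put in front. *)
Lemma independent_of_history k t : (k <= t.1.2)%N -> independent_of P (history k) (xi t).
Proof.
move=> kt _ B [A mA ->] mB; rewrite historyE.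
set m := #|_| in A mA *.
pose J (i : 'I_m.+1) := if unlift ord0 i is Some j then past_index j else t.
pose A' (i : 'I_m.+1) := if unlift ord0 i is Some j then A (past_index j) else B.
have J_inj : injective J.
  move=> i i'; rewrite /J; case: unliftP => [j|] ->; case: unliftP => [j'|] -> //.
  - by move=> /past_index_inj ->.
  - by move=> e; have := past_index_lt j; rewrite e ltnNge kt.
  - by move=> e; have := past_index_lt j'; rewrite -e ltnNge kt.
have mA' i : measurable (A' i) by rewrite /A'; case: unliftP.
have := xi_indep J_inj mA'; rewrite big_ord_recl /J /A' unlift_none.
under eq_bigr => i _ do rewrite liftK.
rewrite -(xi_indep (@past_index_inj k) (fun i => mA (past_index i))) muleC => <-.
congr (P _); apply/seteqP; split => w /=.
  by move=> [h hB] i _; case: unliftP => [j|] _ //; exact: h.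
move=> h; split; last by have := h ord0 I; rewrite unlift_none.
by move=> j _; have := h (lift ord0 j) I; rewrite liftK.
Qed.

End history.

Section measurable_run.
Context {d dU : measure_display} {T : measurableType d} {U : measurableType dU}
  {R : realType} {n p : nat}.

Definition measurable_state (S : T -> @state R n p) : Prop :=
  [/\ measurable_mx (fun w => st_X (S w)), measurable_mx (fun w => st_Hx (S w)) &
      measurable_mx (fun w => st_Ex (S w))] /\
  [/\ measurable_mx (fun w => st_Y (S w)), measurable_mx (fun w => st_Hy (S w)) &
      measurable_mx (fun w => st_Ey (S w))].

Variables (W : 'M[R]_n) (f : 'I_n -> 'rV[R]_p -> R) (L : R)
  (C : U -> 'rV[R]_p -> 'rV[R]_p) (alphax alphay gamma eta : R).
Hypothesis f_lip : forall i, lipschitz_grad L (f i).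
Hypothesis C_meas : measurable_operator C.

Lemma measurable_efcgt_step (u : call -> 'I_n -> T -> U) (S : T -> @state R n p) :
  (forall c i, measurable_fun setT (u c i)) -> measurable_state S ->
  measurable_state (fun w => efcgt_step W f alphax alphay gamma eta
    (fun c Z => compress C (fun i => u c i w) Z) (S w)).
Proof.
move=> mu [[mX mHx mEx] [mY mHy mEy]].
have stE (s : @state R n p) :
    s = State (st_X s) (st_Hx s) (st_Ex s) (st_Y s) (st_Hy s) (st_Ey s) by case: s.
under eq_fun => w do rewrite (stE (S w)).
have mcomp c V : measurable_mx V -> measurable_mx (fun w => compress C (u c ^~ w) (V w)).
  by move=> mV; apply: measurable_compress.
have mQx := mcomp CallQx _ (measurable_mxB mX mHx).
have mQxh := mcomp CallQxhat _ (measurable_mxB (measurable_mxD mEx mX) mHx).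
have mQy := mcomp CallQy _ (measurable_mxB mY mHy).
have mQyh := mcomp CallQyhat _ (measurable_mxB (measurable_mxD mEy mY) mHy).
have mX' : measurable_mx (fun w => st_X (S w) - gamma *: ((1%:M - W) *m (st_Hx (S w)
    + compress C (u CallQxhat ^~ w) (st_Ex (S w) + st_X (S w) - st_Hx (S w))))
    - eta *: st_Y (S w)).
  apply: measurable_mxB; last exact: measurable_mxZ.
  apply: measurable_mxB => //; apply/measurable_mxZ/measurable_mx_mull.
  exact: measurable_mxD.
split; split => //=.
- by apply: measurable_mxD => //; exact: measurable_mxZ.
- by apply: measurable_mxB => //; apply: measurable_mxB => //; exact: measurable_mxD.
- apply: measurable_mxB; last exact: measurable_stacked_grad f_lip mX.
  apply: measurable_mxD; last exact: measurable_stacked_grad f_lip mX'.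
  apply: measurable_mxB => //; apply/measurable_mxZ/measurable_mx_mull.
  exact: measurable_mxD.
- by apply: measurable_mxD => //; exact: measurable_mxZ.
- by apply: measurable_mxB => //; apply: measurable_mxB => //; exact: measurable_mxD.
Qed.

End measurable_run.

Section run_history.
Context {d dU : measure_display} {Omega : measurableType d}
  {U : measurableType dU} {R : realType} {n p : nat}.
Variable P : probability Omega R.
Variable xi : call * nat * 'I_n -> {RV P >-> U}.
Variables (W : 'M[R]_n) (f : 'I_n -> 'rV[R]_p -> R) (L : R)
  (C : U -> 'rV[R]_p -> 'rV[R]_p) (alphax alphay gamma eta : R)
  (X0 Hx0 Hy0 : 'M[R]_(n, p)).
Hypothesis f_lip : forall i, lipschitz_grad L (f i).
Hypothesis C_meas : measurable_operator C.

Definition run (k : nat) (w : Omega) : @state R n p :=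
  efcgt W f C alphax alphay gamma eta X0 Hx0 Hy0 (fun t => xi t w) k.

(** The state at iteration [k] depends only on the seeds of the iterations before
    [k]. *)
Lemma measurable_run k :
  measurable_state (run k : g_sigma_algebraType (history xi k) -> @state R n p).
Proof.
elim: k => [|k [[mX mHx mEx] [mY mHy mEy]]].
  by split; split; exact: measurable_mx_cst.
have up (V : Omega -> 'M[R]_(n, p)) :
    measurable_mx (V : g_sigma_algebraType (history xi k) -> 'M[R]_(n, p)) ->
    measurable_mx (V : g_sigma_algebraType (history xi k.+1) -> 'M[R]_(n, p)).
  by move=> mV i j; apply: measurable_fun_coarser (mV i j); exact: history_sub.
apply: (@measurable_efcgt_step _ _ (g_sigma_algebraType (history xi k.+1)) _ _ _ _
  W f L C alphax alphay gamma eta f_lip C_meas (fun c i w => xi (c, k, i) w) (run k)).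
  by move=> c i; exact: seed_history.
by split; split; exact: up.
Qed.

End run_history.

(** * Spectral radius of a nonnegative matrix *)

Section nonnegative_spectral_radius.
Context {R : realType}.
Local Notation normc := (@ComplexField.Normc.normc R).

Lemma normc_ge0 (x : R[i]) : 0 <= normc x.
Proof. by case: x => a b; exact: sqrtr_ge0. Qed.

Lemma normc_real (x : R) : 0 <= x -> normc (x%:C)%C = x.
Proof. by move=> x0; rewrite /normc /= expr0n addr0 sqrtr_sqr ger0_norm. Qed.

Lemma normc_sum n (F : 'I_n -> R[i]) : normc (\sum_i F i) <= \sum_i normc (F i).
Proof.
elim: n F => [|n IHn] F; first by rewrite !big_ord0 ComplexField.Normc.normc0.
rewrite !big_ord_recl; apply: le_trans (le_normcD _ _) _.
by rewrite lerD2l IHn.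
Qed.

(** For a left eigenvector [v] with eigenvalue [l], nonnegativity gives
    [|l| |v| <= |v| A] entrywise; pairing with [w] yields
    [|l| <|v|, w> <= r <|v|, w>], and this pairing is positive. *)
Lemma spectral_radius_le n (A : 'M[R]_n) (w : 'cV[R]_n) (r : R) :
  0 <= r -> (forall i j, 0 <= A i j) -> (forall i, 0 < w i 0) ->
  (forall i, (A *m w) i 0 <= r * w i 0) -> spectral_radius A <= r.
Proof.
move=> r0 A0 w0 Aw; rewrite /spectral_radius; set E := [set _ | _ in _].
have [->|/set0P E0] := eqVneq E set0; first by rewrite sup0.
apply: ge_sup => // _ [l /= /eigenvalueP [v vA v0] <-].
set m := fun j => normc (v 0 j).
have m0 j : 0 <= m j by exact: normc_ge0.
have hcol j : normc l * m j <= \sum_i m i * A i j.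
  have /rowP/(_ j) := vA; rewrite !mxE => e.
  rewrite -ComplexField.Normc.normcM -e; apply: le_trans (normc_sum _) _.
  by apply: ler_sum => i _; rewrite mxE ComplexField.Normc.normcM normc_real.
have S0 : 0 < \sum_j m j * w j 0.
  have [j vj] : exists j, v 0 j != 0.
    apply/existsP; apply: contraNT v0; rewrite negb_exists => /forallP h.
    by apply/eqP/rowP => j; rewrite mxE; apply/eqP; move: (h j); rewrite negbK.
  rewrite (bigD1 j) //= ltr_pwDl //.
    rewrite mulr_gt0 // lt_def m0 andbT; apply: contra vj => /eqP.
    by move/ComplexField.Normc.eq0_normc ->.
  by apply: sumr_ge0 => i _; rewrite mulr_ge0 // ltW.
rewrite -(ler_pM2r S0) mulr_sumr.
apply: (@le_trans _ _ (\sum_j \sum_i m i * A i j * w j 0)).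
  apply: ler_sum => j _; rewrite mulrA -mulr_suml.
  by rewrite ler_wpM2r // ltW.
rewrite exchange_big mulr_sumr; apply: ler_sum => i _.
rewrite mulrCA; apply: le_trans (ler_wpM2l (m0 i) (Aw i)).
by rewrite mxE mulr_sumr; apply: le_of_eq;
  apply: eq_bigr => j _; rewrite mulrA.
Qed.

End nonnegative_spectral_radius.

(** * The weight vector *)

Section weights.
Context {R : realFieldType}.
Variables (nR L mu s gamma eta delta dx dy tx ty d1 d2 d3 d4 : R).
Variables (e1 e2 e3 e4 e5 e6 e7 : R).
Local Notation kappa := (L / mu).
Local Notation rhot := (1 - gamma * s).
Local Notation q := ((1 + rhot ^+ 2) / 2).
Local Notation r := (1 - eta * mu / 2).
Local Notation m2 := (3 * d2 * e2 + 3 * d2 * e4 + d2 * e5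
            + 18 * d2 / delta * e6 + 6 * d2 / delta * e7).
Local Notation m3 := (2 * nR * tx * e1 + 2 * tx * e2 + tx * e3 + d3 * e2 + d3 * e4
            + 6 * d3 * e6 / delta + e4 / (2 * kappa)).
Local Notation m4 := (6 * nR * ty * e1 + 6 * ty * e2 + 3 * ty * e3 + 3 * d4 * e2
            + d4 * e3 + 3 * d4 * e4 + d4 * e5 + 18 * d4 / delta * e6
            + 6 * d4 / delta * e7 + e5 / (2 * kappa)).
Local Notation S := (2 * nR * e1 + 2 * e2 + e3).

Hypotheses (nR0 : 0 < nR) (mu0 : 0 < mu) (muL : mu <= L) (s0 : 0 < s) (s1 : s <= 1).
Hypotheses (g0 : 0 < gamma) (g1 : gamma <= 1) (eta0 : 0 < eta).
Hypotheses (delta0 : 0 < delta) (delta1 : delta <= 1).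
Hypotheses (d1E : d1 = 2 / s) (d20 : 0 <= d2) (d30 : 0 <= d3) (d40 : 0 <= d4).
Hypotheses (tx0 : 0 <= tx) (ty0 : 0 <= ty).
Hypotheses (he1 : 0 < e1) (he2 : 0 < e2) (he3 : 0 < e3) (he4 : 0 < e4)
  (he5 : 0 < e5) (he6 : 0 < e6) (he7 : 0 < e7).

Let L0 : 0 < L. Proof. exact: lt_le_trans muL. Qed.
Let kappa0 : 0 < kappa. Proof. by rewrite divr_gt0. Qed.
Let S0 : 0 < S. Proof. by rewrite !addr_gt0 // !mulr_gt0. Qed.
Let e3S : e3 <= S.
Proof. by rewrite lerDr addr_ge0 // !mulr_ge0 // ltW. Qed.

(* The three upper bounds on [eta]: the first two are used in the form of [etaS]
   and [eta3] below, cleared of denominators. *)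
Hypothesis eta_opt : eta <= s * e3 / (6 * kappa * S) * (gamma / L).
Hypothesis eta_cons : eta <= s * e2 / (4 * kappa * e3) * (gamma / L).
Hypothesis eta_comp : eta <= delta / (2 * mu).

Let etaS : 6 * (eta * L ^+ 2 * S) <= s * e3 * gamma * mu.
Proof.
have -> : s * e3 * gamma * mu =
    6 * L ^+ 2 * S * (s * e3 / (6 * kappa * S) * (gamma / L)).
  by field; rewrite !gt_eqF.
have -> : 6 * (eta * L ^+ 2 * S) = 6 * L ^+ 2 * S * eta by ring.
by rewrite ler_pM2l // !mulr_gt0 // exprn_gt0.
Qed.

Let eta3 : 4 * (eta * L ^+ 2 * e3) <= s * e2 * gamma * mu.
Proof.
have -> : s * e2 * gamma * mu =
    4 * L ^+ 2 * e3 * (s * e2 / (4 * kappa * e3) * (gamma / L)).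
  by field; rewrite !gt_eqF.
have -> : 4 * (eta * L ^+ 2 * e3) = 4 * L ^+ 2 * e3 * eta by ring.
by rewrite ler_pM2l // !mulr_gt0 // exprn_gt0.
Qed.

(** Since [S >= e3], the first bound on [eta] is a bound on [eta L^2]. *)
Lemma eta_sqr_le : 6 * (eta * L ^+ 2) <= s * gamma * mu.
Proof.
rewrite -(ler_pM2r he3); apply: le_trans (_ : _ <= 6 * (eta * L ^+ 2 * S)) _.
  by rewrite [leRHS]mulrA ler_pM2l // !mulr_gt0 // exprn_gt0.
by apply: le_trans etaS _; apply: le_of_eq; ring.
Qed.

(** Hence [eta mu] takes at most one sixth of the contraction [gamma s] of the
    gossip, which leaves room for the other terms of the consensus and tracking
    rows. *)
Lemma eta_mu_le : 6 * (eta * mu) <= s * gamma.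
Proof.
rewrite -(ler_pM2r mu0); apply: le_trans eta_sqr_le.
by rewrite -!mulrA ler_pM2l // ler_pM2l // -expr2 ler_pXn2r ?nnegrE // ltW.
Qed.

Let etaL : eta * L <= gamma.
Proof.
have : 6 * (eta * L) * L <= gamma * L.
  rewrite -!mulrA -expr2; apply: le_trans eta_sqr_le _.
  apply: (@le_trans _ _ (gamma * mu)); last by rewrite ler_pM2l.
  by rewrite ler_pM2r // ler_piMl // ltW.
rewrite ler_pM2r // => h; apply: le_trans h.
by have := mulr_gt0 eta0 L0; lra.
Qed.

Let etaL2 : L ^+ 2 * eta ^+ 2 <= gamma ^+ 2.
Proof.
by rewrite mulrC -exprMn ler_pXn2r ?nnegrE // ?mulr_ge0 // ltW.
Qed.

Let q_le : q <= 1 - gamma * s / 2.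
Proof.
have gs : gamma * s <= 1 by rewrite mulr_ile1 // ltW.
have gs0 : 0 < gamma * s by rewrite mulr_gt0.
set x := gamma * s in gs gs0 *.
have : x ^+ 2 <= x by rewrite expr2 ler_piMr // ltW.
have -> : (1 - x) ^+ 2 = 1 - 2 * x + x ^+ 2 by ring.
lra.
Qed.

Lemma rate_ge0 : 0 <= r.
Proof.
have := eta_mu_le; have : s * gamma <= 1 by rewrite mulr_ile1 // ltW.
by lra.
Qed.

Lemma rate_lt1 : r < 1.
Proof. by have := mulr_gt0 eta0 mu0; lra. Qed.

Lemma weight_row1 : 3 * kappa ^+ 2 / nR * e2 <= e1 ->
  (1 - 3 / 2 * eta * mu) * e1 + 3 * eta * L ^+ 2 / (mu * nR) * e2 <= r * e1.
Proof.
move=> h; have -> : 3 * eta * L ^+ 2 / (mu * nR) * e2 =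
    eta * mu * (3 * kappa ^+ 2 / nR * e2) by field; rewrite !gt_eqF.
have : eta * mu * (3 * kappa ^+ 2 / nR * e2) <= eta * mu * e1.
  by rewrite ler_pM2l // mulr_gt0.
by lra.
Qed.

(** The gossip gains [gamma s / 2].  The two compression terms cost
    [gamma s / 8] each, the tracking term costs [eta mu / 2], and the rate itself
    another [eta mu / 2]. *)
Lemma weight_row2 : 4 * d1 * d2 * e4 <= e2 -> 24 * d1 * d2 * e6 / delta <= e2 ->
  q * e2 + d1 * (eta ^+ 2 / gamma) * (L ^+ 2 * e3) + d2 * gamma * e4
  + 6 * d2 / delta * gamma * e6 <= r * e2.
Proof.
rewrite d1E => h4 h6.
have h1 : 2 / s * (eta ^+ 2 / gamma) * (L ^+ 2 * e3) <= eta * mu / 2 * e2.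
  have -> : 2 / s * (eta ^+ 2 / gamma) * (L ^+ 2 * e3) =
      eta / (2 * s * gamma) * (4 * (eta * L ^+ 2 * e3)).
    by field; rewrite !gt_eqF.
  have -> : eta * mu / 2 * e2 = eta / (2 * s * gamma) * (s * e2 * gamma * mu).
    by field; rewrite !gt_eqF.
  by rewrite ler_pM2l // divr_gt0 // !mulr_gt0.
have sg0 : 0 < s * gamma / 8 by rewrite divr_gt0 // mulr_gt0.
have h2 : d2 * gamma * e4 <= s * gamma / 8 * e2.
  have -> : d2 * gamma * e4 = s * gamma / 8 * (4 * (2 / s) * d2 * e4).
    by field; rewrite !gt_eqF.
  by rewrite ler_pM2l.
have h3 : 6 * d2 / delta * gamma * e6 <= s * gamma / 8 * e2.
  have -> : 6 * d2 / delta * gamma * e6 =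
      s * gamma / 8 * (24 * (2 / s) * d2 * e6 / delta).
    by field; rewrite !gt_eqF.
  by rewrite ler_pM2l.
have h5 : q * e2 <= (1 - gamma * s / 2) * e2 by rewrite ler_pM2r.
have h7 : 6 * (eta * mu) * e2 <= s * gamma * e2 by rewrite ler_pM2r // eta_mu_le.
have h8 : 0 < s * gamma * e2 by rewrite !mulr_gt0.
by lra.
Qed.

(** After division by [L^2], the terms carrying [eta^2] add up to a multiple of
    [S] and cost [eta mu], the others add up to [gamma m2] and cost
    [gamma s / 4].  With the [eta mu / 2] of the rate, this uses up the gain
    [gamma s / 2] by [eta_mu_le]. *)
Lemma weight_row3 : 4 * m2 / s <= e3 ->
  6 * nR * d1 * L ^+ 4 * (eta ^+ 2 / gamma) * e1
  + (3 * d2 * L ^+ 2 * gamma + 6 * d1 * L ^+ 4 * (eta ^+ 2 / gamma)) * e2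
  + (q + 3 * d1 * L ^+ 2 * (eta ^+ 2 / gamma)) * (L ^+ 2 * e3)
  + 3 * d2 * L ^+ 2 * gamma * e4 + d2 * gamma * (L ^+ 2 * e5)
  + 18 * d2 / delta * L ^+ 2 * gamma * e6
  + 6 * d2 / delta * gamma * (L ^+ 2 * e7) <= r * (L ^+ 2 * e3).
Proof.
rewrite d1E => h.
have h1 : 3 * (2 / s) * L ^+ 2 * (eta ^+ 2 / gamma) * S <= eta * mu * e3.
  have -> : 3 * (2 / s) * L ^+ 2 * (eta ^+ 2 / gamma) * S =
      eta / (s * gamma) * (6 * (eta * L ^+ 2 * S)).
    by field; rewrite !gt_eqF.
  have -> : eta * mu * e3 = eta / (s * gamma) * (s * e3 * gamma * mu).
    by field; rewrite !gt_eqF.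
  by rewrite ler_pM2l // divr_gt0 // !mulr_gt0.
have h2 : gamma * m2 <= s * gamma / 4 * e3.
  have -> : gamma * m2 = s * gamma / 4 * (4 * m2 / s) by field; rewrite !gt_eqF.
  by rewrite ler_pM2l // divr_gt0 // mulr_gt0.
have h5 : q * e3 <= (1 - gamma * s / 2) * e3 by rewrite ler_pM2r.
have h7 : 6 * (eta * mu) * e3 <= s * gamma * e3 by rewrite ler_pM2r // eta_mu_le.
have main : q * e3 + gamma * m2 + 3 * (2 / s) * L ^+ 2 * (eta ^+ 2 / gamma) * S
    <= r * e3 by lra.
have L2 : 0 < L ^+ 2 by rewrite exprn_gt0.
have -> : r * (L ^+ 2 * e3) = L ^+ 2 * (r * e3) by ring.
rewrite -(ler_pM2l L2) in main; apply: le_trans main.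
by apply: le_of_eq; ring.
Qed.

(* The common pattern of the two rows of compression errors: all terms
   other than [d e] add up to at most [gamma^2 X], and [gamma <= 1]. *)
Let gamma_row (X e d : R) : 0 <= X -> 0 <= e -> 0 < X + e / (2 * kappa) ->
  gamma <= (1 - d) / (X + e / (2 * kappa)) * e ->
  gamma ^+ 2 * X + d * e <= r * e.
Proof.
move=> X0 e0 m0 h.
have h1 : gamma * (X + e / (2 * kappa)) <= (1 - d) * e.
  by move: h; rewrite mulrAC ler_pdivlMr.
have h2 : gamma ^+ 2 * X <= gamma * X.
  by rewrite expr2 -mulrA ler_piMl // mulr_ge0 // ltW.
have h3 : eta * mu / 2 * e <= gamma * (e / (2 * kappa)).
  have -> : eta * mu / 2 * e = (eta * L) * (e / (2 * kappa)).
    by field; rewrite !gt_eqF.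
  by rewrite ler_wpM2r // divr_ge0 // mulr_ge0 // ltW.
by lra.
Qed.

Lemma weight_row4 : gamma <= (1 - dx) / m3 * e4 ->
  2 * nR * tx * L ^+ 2 * eta ^+ 2 * e1
  + (d3 * gamma ^+ 2 + 2 * tx * L ^+ 2 * eta ^+ 2) * e2
  + tx * eta ^+ 2 * (L ^+ 2 * e3) + (dx + d3 * gamma ^+ 2) * e4
  + 6 * d3 / delta * gamma ^+ 2 * e6 <= r * e4.
Proof.
pose X := tx * S + d3 * e2 + d3 * e4 + 6 * d3 * e6 / delta.
have X0 : 0 <= X by rewrite /X !addr_ge0 ?mulr_ge0 ?invr_ge0 ?mulr_ge0 // ltW.
have m0 : 0 < X + e4 / (2 * kappa) by rewrite ltr_wpDl // divr_gt0 // mulr_gt0.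
have -> : m3 = X + e4 / (2 * kappa) by rewrite /X; ring.
move=> /(gamma_row X0 (ltW he4) m0); apply: le_trans.
have h : tx * S * (L ^+ 2 * eta ^+ 2) <= tx * S * gamma ^+ 2.
  by rewrite ler_wpM2l // mulr_ge0 // ltW.
rewrite -subr_ge0 in h; rewrite -subr_ge0; apply: le_trans h _.
by apply: le_of_eq; rewrite /X; ring.
Qed.

Lemma weight_row5 : gamma <= (1 - dy) / m4 * e5 ->
  6 * nR * ty * L ^+ 4 * eta ^+ 2 * e1
  + (3 * d4 * L ^+ 2 * gamma ^+ 2 + 6 * ty * L ^+ 4 * eta ^+ 2) * e2
  + (3 * ty * L ^+ 2 * eta ^+ 2 + d4 * gamma ^+ 2) * (L ^+ 2 * e3)
  + 3 * d4 * L ^+ 2 * gamma ^+ 2 * e4 + (dy + d4 * gamma ^+ 2) * (L ^+ 2 * e5)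
  + 18 * d4 / delta * L ^+ 2 * gamma ^+ 2 * e6
  + 6 * d4 / delta * gamma ^+ 2 * (L ^+ 2 * e7) <= r * (L ^+ 2 * e5).
Proof.
pose X := 3 * ty * S + (3 * d4 * e2 + d4 * e3 + 3 * d4 * e4 + d4 * e5
  + 18 * d4 / delta * e6 + 6 * d4 / delta * e7).
have X0 : 0 <= X by rewrite /X !addr_ge0 ?mulr_ge0 ?invr_ge0 ?mulr_ge0 // ltW.
have m0 : 0 < X + e5 / (2 * kappa) by rewrite ltr_wpDl // divr_gt0 // mulr_gt0.
have -> : m4 = X + e5 / (2 * kappa) by rewrite /X; ring.
move=> /(gamma_row X0 (ltW he5) m0) main.
have L2 : 0 < L ^+ 2 by rewrite exprn_gt0.
have -> : r * (L ^+ 2 * e5) = L ^+ 2 * (r * e5) by ring.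
rewrite -(ler_pM2l L2) in main; apply: le_trans main.
have h : L ^+ 2 * (3 * ty * S * (L ^+ 2 * eta ^+ 2)) <= L ^+ 2 * (3 * ty * S * gamma ^+ 2).
  by rewrite ler_pM2l // ler_wpM2l // !mulr_ge0 // ltW.
rewrite -subr_ge0 in h; rewrite -subr_ge0; apply: le_trans h _.
by apply: le_of_eq; rewrite /X; ring.
Qed.

(** Used for both feedback memories, with [(e4, e6)] and [L^2 (e5, e7)]. *)
Lemma weight_row6 (e e' : R) : 0 < e' -> 8 * (1 - delta) * e / delta ^+ 2 <= e' ->
  2 * (1 - delta) / delta * e + (1 - delta / 2) * e' <= r * e'.
Proof.
move=> e'0 h; have h1 : 2 * (1 - delta) / delta * e <= delta / 4 * e'.
  have -> : 2 * (1 - delta) / delta * e =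
      delta / 4 * (8 * (1 - delta) * e / delta ^+ 2) by field; rewrite gt_eqF.
  by rewrite ler_pM2l // divr_gt0.
have h2 : 2 * (eta * mu) <= delta.
  by move: eta_comp; rewrite ler_pdivlMr ?mulr_gt0 // => h'; lra.
have h3 : 2 * (eta * mu) * e' <= delta * e' by rewrite ler_pM2r.
by lra.
Qed.

End weights.

(** * One iteration along a realization *)

Section pathwise.
Context {R : realType} {n p : nat}.
Hypothesis n_gt0 : (0 < n)%N.
Variables (W : 'M[R]_n) (f : 'I_n -> 'rV[R]_p -> R) (L mu : R) (xs : 'rV[R]_p).
Hypothesis hW : doubly_stochastic W.
Hypothesis f_diff : forall i x, differentiable (f i) x.
Hypothesis f_lip : forall i, lipschitz_grad L (f i).
Hypothesis L_ge0 : 0 <= L.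
Hypothesis f_convex : strongly_convex mu (average f).
Hypothesis mu_gt0 : 0 < mu.
Hypothesis xs_min : forall y, average f xs <= average f y.
Variables (alphax alphay gamma eta : R).
Local Notation rho := (spectral_norm (W - n%:R^-1 *: const_mx 1)).
Local Notation nIW := (spectral_norm (1%:M - W)).
Local Notation s := (1 - rho).
Hypothesis hrho : rho < 1.
Hypothesis hgamma : 0 < gamma <= 1.
Hypothesis eta_gt0 : 0 < eta.

Definition optimization_error (st : @state R n p) := sqn (row_mean (st_X st) - xs).
Definition consensus_error (st : @state R n p) :=
  sqn (st_X st - consensus_part (st_X st)).
Definition tracking_error (st : @state R n p) :=
  sqn (st_Y st - consensus_part (st_Y st)).
Definition compression_error_x (st : @state R n p) := sqn (st_X st - st_Hx st).
Definition compression_error_y (st : @state R n p) := sqn (st_Y st - st_Hy st).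
Definition feedback_error_x (st : @state R n p) := sqn (st_Ex st).
Definition feedback_error_y (st : @state R n p) := sqn (st_Ey st).

Definition tracking (st : @state R n p) : Prop :=
  row_mean (st_Y st) = row_mean (stacked_grad f (st_X st)).

Variables (cmp : call -> 'M[R]_(n, p) -> 'M[R]_(n, p)) (st : @state R n p).
Local Notation st' := (efcgt_step W f alphax alphay gamma eta cmp st).
Local Notation ddx := (sqn (st_Ex st - st_Ex st')).
Local Notation ddy := (sqn (st_Ey st - st_Ey st')).
Local Notation dX := (sqn (st_X st' - st_X st)).
Local Notation dY := (sqn (st_Y st' - st_Y st)).

(** What is transmitted is [H + (E + X - H - E') = X + (E - E')], where [E'] is the
    new feedback memory: the reference [H] cancels. *)
Lemma step_XE : st_X st' = st_X st
  - gamma *: ((1%:M - W) *m (st_X st + (st_Ex st - st_Ex st'))) + - eta *: st_Y st.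
Proof.
case: (st) => X Hx Ex Y Hy Ey /=; rewrite scaleNr.
congr (_ - gamma *: (_ *m _) - _).
by apply/matrixP => i j; rewrite !mxE; ring.
Qed.

Lemma step_YE : st_Y st' = st_Y st
  - gamma *: ((1%:M - W) *m (st_Y st + (st_Ey st - st_Ey st')))
  + (stacked_grad f (st_X st') - stacked_grad f (st_X st)).
Proof.
case: (st) => X Hx Ex Y Hy Ey /=; rewrite -addrA.
congr (_ - gamma *: (_ *m _) + _).
by apply/matrixP => i j; rewrite !mxE; ring.
Qed.

Lemma tracking_step : tracking st -> tracking st'.
Proof.
move=> h; rewrite /tracking step_YE mean_gossip_step // h.
by rewrite row_meanD row_meanN addrC subrK.
Qed.

Lemma optimization_step : tracking st -> mu <= L -> 6 * (eta * L ^+ 2) <= mu ->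
  optimization_error st' <= (1 - 3 / 2 * eta * mu) * optimization_error st
  + 3 * eta * L ^+ 2 / (mu * n%:R) * consensus_error st.
Proof.
move=> h muL etaL; rewrite /optimization_error step_XE mean_gossip_step //.
rewrite row_meanZ h scaleNr.
exact: (optimization_error_step n_gt0 f_diff f_lip L_ge0 f_convex mu_gt0 xs_min).
Qed.

Let gs0 : 0 < gamma * s.
Proof. by case/andP: hgamma => g0 _; rewrite mulr_gt0 // subr_gt0. Qed.
Let g0 : 0 < gamma. Proof. by case/andP: hgamma. Qed.
Let s0 : 0 < s. Proof. by rewrite subr_gt0. Qed.

Lemma consensus_step : consensus_error st' <=
  (1 + (1 - gamma * s) ^+ 2) / 2 * consensus_error st
  + 2 / s * (eta ^+ 2 / gamma) * tracking_error st
  + 2 / s * nIW ^+ 2 * gamma * ddx.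
Proof.
rewrite /consensus_error step_XE.
apply: le_trans (disagreement_gossip_step n_gt0 hW hgamma hrho _ _ _) _.
rewrite [X in sqn (X - st_X st)]addrC addrK consensus_partZ -scalerBr.
rewrite sqnZ sqrrN -/(tracking_error _) -/(consensus_error _) -addrA lerD2l.
by apply: le_of_eq; field; rewrite !gt_eqF.
Qed.

Lemma increment_X_step : tracking st ->
  dX <= 3 * (gamma ^+ 2 * nIW ^+ 2 * ddx + gamma ^+ 2 * nIW ^+ 2 * consensus_error st
    + eta ^+ 2 * (tracking_error st + 2 * n%:R * L ^+ 2 * optimization_error st
                  + 2 * L ^+ 2 * consensus_error st)).
Proof.
move=> h; rewrite step_XE.
apply: le_trans (gossip_increment gamma hW _ _ _) _.
rewrite [X in sqn (X - st_X st)]addrC addrK -/(consensus_error _).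
rewrite ler_pM2l // lerD2l sqnZ sqrrN ler_wpM2l ?sqr_ge0 //.
exact: (sqn_tracking_le n_gt0 f_diff f_lip L_ge0 xs_min).
Qed.

Lemma tracking_error_step : tracking_error st' <=
  (1 + (1 - gamma * s) ^+ 2) / 2 * tracking_error st
  + 2 / s * nIW ^+ 2 * gamma * ddy + 2 / s / gamma * L ^+ 2 * dX.
Proof.
rewrite /tracking_error step_YE.
set D := stacked_grad f (st_X st') - _.
apply: le_trans (disagreement_gossip_step n_gt0 hW hgamma hrho _ _ _) _.
rewrite [X in sqn (X - st_Y st)]addrC addrK.
rewrite -/(tracking_error _) -[leRHS]addrA lerD2l.
have h : sqn (D - consensus_part D) <= L ^+ 2 * dX.
  apply: le_trans (sqn_disagreement_le n_gt0 _) _.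
  exact: (sqn_stacked_grad_le f_lip L_ge0).
have c0 : 0 < (gamma * s)^-1 * 2 by rewrite mulr_gt0 ?invr_gt0.
have := h; rewrite -(ler_pM2l c0) => {}h; rewrite mulrA mulrDr.
apply: le_trans (lerD (lexx _) h) _.
by apply: le_of_eq; field; rewrite !gt_eqF.
Qed.

Lemma increment_Y_step :
  dY <= 3 * (gamma ^+ 2 * nIW ^+ 2 * ddy + gamma ^+ 2 * nIW ^+ 2 * tracking_error st
    + L ^+ 2 * dX).
Proof.
rewrite step_YE; apply: le_trans (gossip_increment gamma hW _ _ _) _.
rewrite [X in sqn (X - st_Y st)]addrC addrK -/(tracking_error _).
by rewrite ler_pM2l // lerD2l (sqn_stacked_grad_le f_lip L_ge0).
Qed.

(** The new compression error is the old one after a relaxed update of the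
    reference point, a convex combination of the uncompressed error and the
    compression residual, plus the motion of the tracked variable. *)
Lemma compression_drift (Z Z' H Q : 'M[R]_(n, p)) (alpha tau : R) :
  0 <= alpha <= 1 -> 1 < tau ->
  sqn (Z' - (H + alpha *: Q)) <=
  tau * ((1 - alpha) * sqn (Z - H) + alpha * sqn (Q - (Z - H)))
  + tau / (tau - 1) * sqn (Z' - Z).
Proof.
move=> ha tau1; have t0 : 0 < tau - 1 by rewrite subr_gt0.
have -> : Z' - (H + alpha *: Q) = ((1 - alpha) *: (Z - H) + alpha *: (Z - H - Q)) + (Z' - Z).
  by apply/matrixP => i j; rewrite !mxE; ring.
apply: le_trans (@sqnD_le _ _ _ _ _ tau (tau / (tau - 1)) tau1 _) _.
  by apply: le_of_eq; field; rewrite gt_eqF.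
rewrite lerD2r ler_pM2l; last exact: lt_trans tau1.
by apply: le_trans (sqn_convex _ _ ha) _; rewrite -(sqnN (Q - _)) opprB.
Qed.

Lemma feedback_step_x :
  st_Ex st' = - (cmp CallQxhat (st_Ex st + st_X st - st_Hx st)
                 - (st_Ex st + st_X st - st_Hx st)).
Proof. by case: (st) => X Hx Ex Y Hy Ey /=; rewrite opprB. Qed.

Lemma feedback_step_y :
  st_Ey st' = - (cmp CallQyhat (st_Ey st + st_Y st - st_Hy st)
                 - (st_Ey st + st_Y st - st_Hy st)).
Proof. by case: (st) => X Hx Ex Y Hy Ey /=; rewrite opprB. Qed.

Lemma reference_step_x :
  st_Hx st' = st_Hx st + alphax *: cmp CallQx (st_X st - st_Hx st).
Proof. by case: (st). Qed.

Lemma reference_step_y :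
  st_Hy st' = st_Hy st + alphay *: cmp CallQy (st_Y st - st_Hy st).
Proof. by case: (st). Qed.

End pathwise.

(** * Compression and feedback errors in the mean *)

Section mean_compression.
Context {d : measure_display} {Omega : measurableType d} {R : realType} {n p : nat}.
Variable P : probability Omega R.
Variable delta : R.
Hypothesis hdelta : 0 < delta <= 1.

(* [E] is the feedback memory, [V] the signal to be transmitted and [E'] the next
   memory, whose mean square is at most [1 - delta] times that of [E + V]. *)
Section feedback.
Variables (E V E' : Omega -> 'M[R]_(n, p)) (e v : R).
Hypotheses (mE : measurable_mx E) (mV : measurable_mx V) (mE' : measurable_mx E').
Hypotheses (hE : mean_le P (fun w => sqn (E w)) e) (hV : mean_le P (fun w => sqn (V w)) v).
Hypothesis hE' : forall m, mean_le P (fun w => sqn (E w + V w)) m ->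
  mean_le P (fun w => sqn (E' w)) ((1 - delta) * m).

Let delta0 : 0 < delta. Proof. by case/andP: hdelta. Qed.
Let delta1 : delta <= 1. Proof. by case/andP: hdelta. Qed.

Let young_mean x y : 1 < x -> 0 <= y -> 1 <= (x - 1) * (y - 1) ->
  mean_le P (fun w => sqn (E w + V w)) (x * e + y * v).
Proof.
move=> x1 y0 xy; have x0 : 0 <= x by rewrite ltW // (lt_trans _ x1).
apply: mean_le_trans (mean_leD (mean_leZ x0 hE) (mean_leZ y0 hV)) (lexx _).
- by apply: measurable_sqn; exact: measurable_mxD.
- by move=> w; exact: sqn_ge0.
- by move=> w; exact: sqnD_le.
Qed.

(** The Young coefficient of [E] is the largest one that still gives the factor
    [1 - delta / 2]; it degenerates for [delta = 1], where the new memory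
    vanishes in mean square. *)
Lemma mean_feedback :
  mean_le P (fun w => sqn (E' w)) (2 * (1 - delta) / delta * v + (1 - delta / 2) * e).
Proof.
have e0 := mean_le_ge0 hE; have v0 := mean_le_ge0 hV.
have [dl0 dl1] := andP hdelta.
have [d1|d1] := eqVneq delta 1.
  have : mean_le P (fun w => sqn (E' w)) ((1 - delta) * (2 * e + 2 * v)).
    by apply: hE'; apply: young_mean; lra.
  by move=> /mean_le_mono; apply; rewrite d1; lra.
have d' : 0 < 1 - delta by rewrite subr_gt0 lt_neqAle d1.
have : mean_le P (fun w => sqn (E' w))
    ((1 - delta) * ((1 - delta / 2) / (1 - delta) * e + (2 - delta) / delta * v)).
  apply: hE'; apply: young_mean.
  - by rewrite ltr_pdivlMr //; lra.
  - by rewrite divr_ge0 // ?(ltW delta0) //; lra.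
  - by apply: le_of_eq; field; rewrite !gt_eqF.
move=> /mean_le_mono; apply; rewrite -subr_ge0.
have -> : 2 * (1 - delta) / delta * v + (1 - delta / 2) * e -
    (1 - delta) * ((1 - delta / 2) / (1 - delta) * e + (2 - delta) / delta * v) =
    (1 - delta) * v by field; rewrite !gt_eqF.
by rewrite mulr_ge0 // ltW.
Qed.

(** Two Young inequalities with coefficients [1 + delta / 2] and [1 + 2 / delta]:
    the factor [(1 - delta) (1 + delta / 2)^2] of [V] remains below 1. *)
Lemma mean_feedback_variation :
  mean_le P (fun w => sqn (E w - E' w)) (v + 6 / delta * e).
Proof.
have e0 := mean_le_ge0 hE; have v0 := mean_le_ge0 hV.
have [dl0 dl1] := andP hdelta.
have h1 : 0 <= 1 + delta / 2 by lra.
have h2 : 0 <= 1 + 2 / delta by rewrite addr_ge0 // divr_ge0 // ltW.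
have x1 : 1 < 1 + 2 / delta by rewrite ltrDl divr_gt0.
have x2 : 1 <= (1 + 2 / delta - 1) * (1 + delta / 2 - 1).
  by apply: le_of_eq; field; rewrite gt_eqF.
have hs := hE' (young_mean x1 h1 x2).
apply: mean_le_trans (mean_leD (mean_leZ h2 hE) (mean_leZ h1 hs)) _.
- by apply: measurable_sqn; exact: measurable_mxB.
- by move=> w; exact: sqn_ge0.
- by move=> w; rewrite -(sqnN (E' w)); exact: sqnD_le.
rewrite -subr_ge0.
have -> : v + 6 / delta * e - ((1 + 2 / delta) * e +
    (1 + delta / 2) * ((1 - delta) * ((1 + 2 / delta) * e + (1 + delta / 2) * v))) =
    (3 / 4 * delta ^+ 2 + delta ^+ 3 / 4) * v
    + ((1 - delta) + 1 + 3 / 2 * delta ^+ 2 + delta ^+ 3 / 2) / delta * e.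
  by field; rewrite gt_eqF.
have d2 : 0 <= delta ^+ 2 by rewrite sqr_ge0.
have d3 : 0 <= delta ^+ 3 by rewrite exprn_ge0 // ltW.
by rewrite addr_ge0 // mulr_ge0 // ?divr_ge0 // ?(ltW delta0) //; lra.
Qed.

End feedback.

Lemma mean_compression_drift (Z Z' H Q : Omega -> 'M[R]_(n, p)) (alpha tau c D : R) :
  0 <= alpha <= 1 -> 1 < tau ->
  measurable_mx (fun w => Z' w - (H w + alpha *: Q w)) ->
  mean_le P (fun w => sqn (Z w - H w)) c ->
  mean_le P (fun w => sqn (Q w - (Z w - H w))) ((1 - delta) * c) ->
  mean_le P (fun w => sqn (Z' w - Z w)) D ->
  mean_le P (fun w => sqn (Z' w - (H w + alpha *: Q w)))
    (tau * (alpha * (1 - delta) + (1 - alpha)) * c + tau / (tau - 1) * D).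
Proof.
move=> ha tau1 mZ hc hQ hD; have t0 : 0 <= tau by rewrite ltW // (lt_trans _ tau1).
have ha1 : 0 <= 1 - alpha by case/andP: ha; rewrite subr_ge0.
have ha0 : 0 <= alpha by case/andP: ha.
have t1 : 0 <= tau / (tau - 1) by rewrite divr_ge0 // subr_ge0 ltW.
apply: (mean_le_trans _ _ _ (mean_leD
  (mean_leZ t0 (mean_leD (mean_leZ ha1 hc) (mean_leZ ha0 hQ))) (mean_leZ t1 hD))).
- exact: measurable_sqn.
- by move=> w; exact: sqn_ge0.
- by move=> w; exact: compression_drift.
- by apply: le_of_eq; ring.
Qed.

End mean_compression.

(** * The linear inequality between consecutive errors *)

Lemma gradient_factor_ge0 (R : realFieldType) (eta mu L : R) :
  0 < eta -> 0 < mu -> mu <= L -> 6 * (eta * L ^+ 2) <= mu ->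
  0 <= 1 - 3 / 2 * eta * mu.
Proof.
move=> eta0 mu0 muL etaL; have L0 : 0 <= L := le_trans (ltW mu0) muL.
have : 6 * (eta * mu) <= 1.
  rewrite -(ler_pM2r mu0) mul1r; apply: le_trans etaL.
  by rewrite -!mulrA !ler_pM2l // -expr2 ler_pXn2r ?nnegrE // ltW.
by lra.
Qed.

Lemma feedback_factor_ge0 (R : realFieldType) (delta : R) :
  delta <= 1 -> 0 <= 1 - delta / 2.
Proof. by lra. Qed.

Section mean_step.
Context {d dU : measure_display} {Omega : measurableType d}
  {U : measurableType dU} {R : realType} {n p : nat}.
Hypothesis n_gt0 : (0 < n)%N.
Variables (P : probability Omega R) (nu : probability U R).
Variable xi : call * nat * 'I_n -> {RV P >-> U}.
Hypothesis xi_law : forall t A, measurable A -> P (xi t @^-1` A) = nu A.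
Hypothesis xi_indep : mutually_independent P (fun t => xi t : Omega -> U).
Variables (W : 'M[R]_n) (f : 'I_n -> 'rV[R]_p -> R) (L mu : R) (xs : 'rV[R]_p).
Hypothesis hW : doubly_stochastic W.
Hypothesis f_diff : forall i x, differentiable (f i) x.
Hypothesis f_lip : forall i, lipschitz_grad L (f i).
Hypothesis L_ge0 : 0 <= L.
Hypothesis f_convex : strongly_convex mu (average f).
Hypothesis mu_gt0 : 0 < mu.
Hypothesis xs_min : forall y, average f xs <= average f y.
Variables (C : U -> 'rV[R]_p -> 'rV[R]_p) (delta : R).
Hypothesis hdelta : 0 < delta <= 1.
Hypothesis C_meas : measurable_operator C.
Hypothesis C_contr : contractive nu C delta.
Variables (alphax alphay gamma eta taux tauy : R) (X0 Hx0 Hy0 : 'M[R]_(n, p)).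
Local Notation rho := (spectral_norm (W - n%:R^-1 *: const_mx 1)).
Local Notation nIW := (spectral_norm (1%:M - W)).
Local Notation s := (1 - rho).
Hypothesis hrho : rho < 1.
Hypothesis hgamma : 0 < gamma <= 1.
Hypothesis eta_gt0 : 0 < eta.
Hypotheses (halphax : 0 < alphax <= 1) (halphay : 0 < alphay <= 1).
Hypotheses (htaux : 1 < taux) (htauy : 1 < tauy).
Hypotheses (muL : mu <= L) (etaL : 6 * (eta * L ^+ 2) <= mu).

Local Notation run := (run xi W f C alphax alphay gamma eta X0 Hx0 Hy0).

Definition mean_errors_le (k : nat) (o c g cx cy ex ey : R) : Prop :=
  [/\ [/\ mean_le P (fun w => optimization_error xs (run k w)) o,
          mean_le P (fun w => consensus_error (run k w)) c &
          mean_le P (fun w => tracking_error (run k w)) g],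
      [/\ mean_le P (fun w => compression_error_x (run k w)) cx &
          mean_le P (fun w => compression_error_y (run k w)) cy] &
      [/\ mean_le P (fun w => feedback_error_x (run k w)) ex &
          mean_le P (fun w => feedback_error_y (run k w)) ey]].

(** Gossip preserves column means and [Y] starts at the local gradients, so the
    increments of the local gradients telescope. *)
Lemma tracking_run k w : tracking f (run k w).
Proof. by elim: k => [//|k IHk]; exact: tracking_step. Qed.

Local Notation nR := (n%:R : R).
Local Notation q := ((1 + (1 - gamma * s) ^+ 2) / 2).
Local Notation dx := (taux * (alphax * (1 - delta) + (1 - alphax))).
Local Notation dy := (tauy * (alphay * (1 - delta) + (1 - alphay))).
Local Notation tx := (3 * taux / (taux - 1)).
Local Notation ty := (3 * tauy / (tauy - 1)).
Local Notation d1 := (2 / s).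
Local Notation d2 := (2 / s * nIW ^+ 2).
Local Notation d3 := (tx * nIW ^+ 2).
Local Notation d4 := (ty * nIW ^+ 2).

(** The bounds on the right are the rows of the transition matrix applied to
    [(o, c, g, cx, cy, ex, ey)].  Each pathwise inequality is integrated term by
    term; what remains is to collect the coefficients. *)
Lemma mean_errors_step k o c g cx cy ex ey :
  mean_errors_le k o c g cx cy ex ey ->
  mean_errors_le k.+1
    ((1 - 3 / 2 * eta * mu) * o + 3 * eta * L ^+ 2 / (mu * nR) * c)
    (q * c + d1 * (eta ^+ 2 / gamma) * g + d2 * gamma * cx
     + 6 * d2 / delta * gamma * ex)
    (6 * nR * d1 * L ^+ 4 * (eta ^+ 2 / gamma) * o
     + (3 * d2 * L ^+ 2 * gamma + 6 * d1 * L ^+ 4 * (eta ^+ 2 / gamma)) * c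
     + (q + 3 * d1 * L ^+ 2 * (eta ^+ 2 / gamma)) * g
     + 3 * d2 * L ^+ 2 * gamma * cx + d2 * gamma * cy
     + 18 * d2 / delta * L ^+ 2 * gamma * ex + 6 * d2 / delta * gamma * ey)
    (2 * nR * tx * L ^+ 2 * eta ^+ 2 * o
     + (d3 * gamma ^+ 2 + 2 * tx * L ^+ 2 * eta ^+ 2) * c
     + tx * eta ^+ 2 * g + (dx + d3 * gamma ^+ 2) * cx
     + 6 * d3 / delta * gamma ^+ 2 * ex)
    (6 * nR * ty * L ^+ 4 * eta ^+ 2 * o
     + (3 * d4 * L ^+ 2 * gamma ^+ 2 + 6 * ty * L ^+ 4 * eta ^+ 2) * c
     + (3 * ty * L ^+ 2 * eta ^+ 2 + d4 * gamma ^+ 2) * g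
     + 3 * d4 * L ^+ 2 * gamma ^+ 2 * cx + (dy + d4 * gamma ^+ 2) * cy
     + 18 * d4 / delta * L ^+ 2 * gamma ^+ 2 * ex
     + 6 * d4 / delta * gamma ^+ 2 * ey)
    (2 * (1 - delta) / delta * cx + (1 - delta / 2) * ex)
    (2 * (1 - delta) / delta * cy + (1 - delta / 2) * ey).
Proof.
move=> [[ho hc hg] [hcx hcy] [hex hey]].
have [g0 g1] := andP hgamma; have [dl0 dl1] := andP hdelta.
have s0 : 0 < s by rewrite subr_gt0.
have nIW0 : 0 <= nIW by exact: spectral_norm_ge0.
have tx1 : 0 < taux - 1 by rewrite subr_gt0.
have ty1 : 0 < tauy - 1 by rewrite subr_gt0.
(* The iterates are needed as functions of the past, for independence, and as
   functions on the whole probability space, for expectations. *)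
have down l (V : Omega -> 'M[R]_(n, p)) :
    measurable_mx (V : g_sigma_algebraType (history xi l) -> 'M[R]_(n, p)) ->
    measurable_mx V.
  by move=> mV i j; exact: (measurable_fun_sub_sigma (@history_measurable _ _ _ _ _ _ P xi l) (mV i j)).
have mrun := measurable_run xi W alphax alphay gamma eta X0 Hx0 Hy0 f_lip C_meas.
have [[mX mHx mEx] [mY mHy mEy]] := mrun k.
have [MX MHx MEx] := And3 (down _ _ mX) (down _ _ mHx) (down _ _ mEx).
have [MY MHy MEy] := And3 (down _ _ mY) (down _ _ mHy) (down _ _ mEy).
have [[mX' mHx' mEx'] [mY' mHy' mEy']] : measurable_state (run k.+1).
  by have [[a1 a2 a3] [a4 a5 a6]] := mrun k.+1; split; split; exact: down.
have contr (c' : call) (Z : Omega -> 'M[R]_(n, p)) m :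
    measurable_mx (Z : g_sigma_algebraType (history xi k) -> 'M[R]_(n, p)) ->
    mean_le P (fun w => sqn (Z w)) m ->
    mean_le P (fun w => sqn (compress C (fun i => xi (c', k, i) w) (Z w) - Z w))
      ((1 - delta) * m).
  move=> mZ hZ; apply: (mean_le_compress dl1 C_meas C_contr (G := history xi k)) => //.
  - exact: history_measurable.
  - exact: history_setI.
  - exact: history_setT.
  - by move=> i B mB; exact: xi_law.
  - by move=> i; apply: independent_of_history.
have mxB (V V' : Omega -> 'M[R]_(n, p)) :
    measurable_mx (V : g_sigma_algebraType (history xi k) -> 'M[R]_(n, p)) ->
    measurable_mx (V' : g_sigma_algebraType (history xi k) -> 'M[R]_(n, p)) ->
    measurable_mx ((fun w => V w - V' w) : g_sigma_algebraType (history xi k) -> 'M[R]_(n, p)).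
  exact: (@measurable_mxB _ (g_sigma_algebraType (history xi k))).
have mxD (V V' : Omega -> 'M[R]_(n, p)) :
    measurable_mx (V : g_sigma_algebraType (history xi k) -> 'M[R]_(n, p)) ->
    measurable_mx (V' : g_sigma_algebraType (history xi k) -> 'M[R]_(n, p)) ->
    measurable_mx ((fun w => V w + V' w) : g_sigma_algebraType (history xi k) -> 'M[R]_(n, p)).
  exact: (@measurable_mxD _ (g_sigma_algebraType (history xi k))).
have resx m : mean_le P (fun w => sqn (st_Ex (run k w) + (st_X (run k w) - st_Hx (run k w)))) m ->
    mean_le P (fun w => sqn (st_Ex (run k.+1 w))) ((1 - delta) * m).
  move=> h; have := contr CallQxhat _ m (mxD _ _ mEx (mxB _ _ mX mHx)) h.
  congr (mean_le P _ _); apply/funext => w; rewrite -[LHS]sqnN addrA; congr sqn.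
  exact/esym/feedback_step_x.
have resy m : mean_le P (fun w => sqn (st_Ey (run k w) + (st_Y (run k w) - st_Hy (run k w)))) m ->
    mean_le P (fun w => sqn (st_Ey (run k.+1 w))) ((1 - delta) * m).
  move=> h; have := contr CallQyhat _ m (mxD _ _ mEy (mxB _ _ mY mHy)) h.
  congr (mean_le P _ _); apply/funext => w; rewrite -[LHS]sqnN addrA; congr sqn.
  exact/esym/feedback_step_y.
have hddx := mean_feedback_variation hdelta MEx (measurable_mxB MX MHx) mEx' hex hcx resx.
have hddy := mean_feedback_variation hdelta MEy (measurable_mxB MY MHy) mEy' hey hcy resy.
have hex' := mean_feedback hdelta MEx (measurable_mxB MX MHx) hex hcx resx.
have hey' := mean_feedback hdelta MEy (measurable_mxB MY MHy) hey hcy resy.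
have G0 : 0 <= gamma ^+ 2 * nIW ^+ 2 by rewrite mulr_ge0 ?sqr_ge0.
have c1 : 0 <= 2 * nR * L ^+ 2 by rewrite !mulr_ge0 ?sqr_ge0.
have c2 : 0 <= 2 * L ^+ 2 by rewrite mulr_ge0 ?sqr_ge0.
have c3 : 0 <= eta ^+ 2 by rewrite sqr_ge0.
have L2 : 0 <= L ^+ 2 by rewrite sqr_ge0.
have hdX : mean_le P (fun w => sqn (st_X (run k.+1 w) - st_X (run k w)))
   (3 * (gamma ^+ 2 * nIW ^+ 2 * (cx + 6 / delta * ex) + gamma ^+ 2 * nIW ^+ 2 * c
    + eta ^+ 2 * (g + 2 * nR * L ^+ 2 * o + 2 * L ^+ 2 * c))).
  apply: (mean_le_trans _ _ _ (mean_leZ (ler0n _ 3) (mean_leD (mean_leD (mean_leZ G0 hddx)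
    (mean_leZ G0 hc)) (mean_leZ c3 (mean_leD (mean_leD hg (mean_leZ c1 ho))
    (mean_leZ c2 hc))))) (lexx _)).
  - by apply: measurable_sqn; exact: measurable_mxB.
  - by move=> w; exact: sqn_ge0.
  - move=> w; apply: (increment_X_step n_gt0 hW f_diff f_lip L_ge0 xs_min).
    exact: tracking_run.
set DX := 3 * _ in hdX.
have hdY : mean_le P (fun w => sqn (st_Y (run k.+1 w) - st_Y (run k w)))
   (3 * (gamma ^+ 2 * nIW ^+ 2 * (cy + 6 / delta * ey) + gamma ^+ 2 * nIW ^+ 2 * g
    + L ^+ 2 * DX)).
  apply: (mean_le_trans _ _ _ (mean_leZ (ler0n _ 3) (mean_leD (mean_leD (mean_leZ G0 hddy)
    (mean_leZ G0 hg)) (mean_leZ L2 hdX))) (lexx _)).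
  - by apply: measurable_sqn; exact: measurable_mxB.
  - by move=> w; exact: sqn_ge0.
  - by move=> w; apply: (increment_Y_step hW f_lip L_ge0).
set DY := 3 * _ in hdY.
have q0 : 0 <= q by rewrite divr_ge0 // addr_ge0 // sqr_ge0.
split; split => //.
- have k1 := gradient_factor_ge0 eta_gt0 mu_gt0 muL etaL.
  have k2 : 0 <= 3 * eta * L ^+ 2 / (mu * nR).
    by rewrite divr_ge0 ?mulr_ge0 ?sqr_ge0 // ltW.
  apply: (mean_le_trans _ _ _ (mean_leD (mean_leZ k1 ho) (mean_leZ k2 hc)) (lexx _)).
  + apply: measurable_sqn; apply: measurable_mxB; last exact: measurable_mx_cst.
    exact: measurable_row_mean.
  + by move=> w; exact: sqn_ge0.
  + move=> w; apply: (optimization_step n_gt0 hW f_diff f_lip L_ge0 f_convex mu_gt0 xs_min) => //.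
    exact: tracking_run.
- have k1 : 0 <= d1 * (eta ^+ 2 / gamma).
    by rewrite mulr_ge0 ?divr_ge0 // ltW.
  have k2 : 0 <= d2 * gamma.
    by rewrite !mulr_ge0 ?invr_ge0 ?sqr_ge0 // ltW.
  apply: (mean_le_trans _ _ _ (mean_leD (mean_leD (mean_leZ q0 hc) (mean_leZ k1 hg))
    (mean_leZ k2 hddx))).
  + by apply: measurable_sqn; apply: measurable_mxB => //; exact: measurable_consensus_part.
  + by move=> w; exact: sqn_ge0.
  + by move=> w; apply: consensus_step.
  + by apply: le_of_eq; field; rewrite !gt_eqF.
- have k1 : 0 <= 2 / s / gamma * L ^+ 2.
    by rewrite mulr_ge0 // divr_ge0 ?divr_ge0 // ltW.
  have k2 : 0 <= d2 * gamma.
    by rewrite !mulr_ge0 ?invr_ge0 ?sqr_ge0 // ltW.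
  apply: (mean_le_trans _ _ _ (mean_leD (mean_leD (mean_leZ q0 hg) (mean_leZ k2 hddy))
    (mean_leZ k1 hdX))).
  + by apply: measurable_sqn; apply: measurable_mxB => //; exact: measurable_consensus_part.
  + by move=> w; exact: sqn_ge0.
  + by move=> w; apply: (tracking_error_step n_gt0 hW f_lip L_ge0).
  + by apply: le_of_eq; rewrite /DX; field; rewrite !gt_eqF.
- have hQ := contr CallQx _ cx (mxB _ _ mX mHx) hcx.
  have hH w : st_Hx (run k w) + alphax *: compress C (fun i => xi (CallQx, k, i) w)
      (st_X (run k w) - st_Hx (run k w)) = st_Hx (run k.+1 w).
    exact/esym/reference_step_x.
  have := mean_compression_drift (alpha := alphax) (tau := taux)
    (Z' := fun w => st_X (run k.+1 w)) _ htaux _ hcx hQ hdX.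
  under eq_fun do rewrite hH.
  under [X in mean_le P X _]eq_fun do rewrite hH.
  move=> h; apply: mean_le_mono (h _ _) _; [|exact: measurable_mxB|].
    by case/andP: halphax => /ltW -> ->.
  by apply: le_of_eq; rewrite /DX; field; rewrite !gt_eqF.
- have hQ := contr CallQy _ cy (mxB _ _ mY mHy) hcy.
  have hH w : st_Hy (run k w) + alphay *: compress C (fun i => xi (CallQy, k, i) w)
      (st_Y (run k w) - st_Hy (run k w)) = st_Hy (run k.+1 w).
    exact/esym/reference_step_y.
  have := mean_compression_drift (alpha := alphay) (tau := tauy)
    (Z' := fun w => st_Y (run k.+1 w)) _ htauy _ hcy hQ hdY.
  under eq_fun do rewrite hH.
  under [X in mean_le P X _]eq_fun do rewrite hH.
  move=> h; apply: mean_le_mono (h _ _) _; [|exact: measurable_mxB|].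
    by case/andP: halphay => /ltW -> ->.
  by apply: le_of_eq; rewrite /DY /DX; field; rewrite !gt_eqF.
Qed.

End mean_step.

(** * Geometric decay *)

Section geometric_decay.
Context {R : realType}.

Lemma mx_of_rows_mul n (rows : seq (seq R)) (v : seq R) (i : 'I_n) :
  (mx_of_rows n rows *m (\col_j v`_j)) i 0 = \sum_(j < n) (nth [::] rows i)`_j * v`_j.
Proof. by rewrite mxE; apply: eq_bigr => j _; rewrite !mxE. Qed.

Lemma mx_of_rows_ge0 n (rows : seq (seq R)) (i j : 'I_n) :
  all (all (fun x => 0 <= x)) rows -> 0 <= mx_of_rows n rows i j.
Proof.
move=> h; rewrite mxE; have [li|li] := ltnP i (size rows); last first.
  by rewrite (nth_default [::]) // nth_nil.
have [lj|lj] := ltnP j (size (nth [::] rows i)); last by rewrite nth_default.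
have /allP := h => /(_ _ (mem_nth [::] li)) /allP; apply; exact: mem_nth.
Qed.

Lemma common_bound (qs : seq R) :
  exists2 K : R, 0 <= K & forall a, a \in qs -> a <= K.
Proof.
exists (\big[Num.max/0]_(a <- qs) a); first exact: bigmax_ge_id.
by move=> a aqs; exact: (@le_bigmax_seq _ _ _ _ 0 a xpredT id).
Qed.

Lemma squeeze_geometric (u : nat -> \bar R) (K r : R) : 0 <= r -> r < 1 ->
  (forall k, 0 <= u k)%E -> (forall k, u k <= (K * r ^+ k)%:E)%E -> u @ \oo --> 0%E.
Proof.
move=> r0 r1 u0 uK.
apply: (@squeeze_cvge _ _ _ _ (fun=> 0%E) _ (fun k => (K * r ^+ k)%:E)).
- by apply: nearW => k; rewrite u0 uK.
- exact: cvg_cst.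
- apply: cvg_EFin; first exact: nearW.
  by apply: cvg_geometric; rewrite ger0_norm.
Qed.

End geometric_decay.

Theorem theorem2 (R : realType) (n p : nat) (hn : (0 < n)%N) (hp : (0 < p)%N)
  (* network *)
  (W : 'M[R]_n)
  (hW : doubly_stochastic W) (hconn : strongly_connected W)
  (hrho : spectral_norm (W - n%:R^-1 *: const_mx 1) < 1)
  (* objective *)
  (f : 'I_n -> 'rV[R]_p -> R) (Li : 'I_n -> R) (mu : R) (xs : 'rV[R]_p)
  (hdiff : forall i x, differentiable (f i) x)
  (hmu : 0 < mu) (hconv : strongly_convex mu (average f))
  (hLip : forall i, lipschitz_grad (Li i) (f i))
  (hxs : unique_minimizer (average f) xs)
  (* compression *)
  (dU : measure_display) (U : measurableType dU) (nu : probability U R)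
  (C : U -> 'rV[R]_p -> 'rV[R]_p) (delta : R)
  (hdelta : 0 < delta <= 1)
  (hCm : measurable_operator C) (hC : contractive nu C delta)
  (* randomness of the run: i.i.d. seeds of law nu *)
  (d : measure_display) (Omega : measurableType d) (P : probability Omega R)
  (xi : call * nat * 'I_n -> {RV P >-> U})
  (hxi_law : forall t A, measurable A -> P (xi t @^-1` A) = nu A)
  (hxi_indep : mutually_independent P (fun t => xi t : Omega -> U))
  (* algorithm parameters and initial values *)
  (alphax alphay gamma eta : R) (X0 Hx0 Hy0 : 'M[R]_(n, p))
  (halphax : 0 < alphax <= 1) (halphay : 0 < alphay <= 1)
  (hgamma : 0 < gamma) (heta : 0 < eta)
  (* constants of the analysis *)
  (taux tauy : R) (htaux : 1 < taux) (htauy : 1 < tauy)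
  (e1 e2 e3 e4 e5 e6 e7 : R)
  (he1 : 0 < e1) (he2 : 0 < e2) (he3 : 0 < e3) (he4 : 0 < e4)
  (he5 : 0 < e5) (he6 : 0 < e6) (he7 : 0 < e7) :
  let nR : R := n%:R in
  let L := \big[Num.max/0]_(i < n) Li i in
  let kappa := L / mu in
  let s := 1 - spectral_norm (W - n%:R^-1 *: const_mx 1) in
  let rhot := 1 - gamma * s in
  let nIW := spectral_norm (1%:M - W) in
  let dx := taux * (alphax * (1 - delta) + (1 - alphax)) in
  let dy := tauy * (alphay * (1 - delta) + (1 - alphay)) in
  let tx := 3 * taux / (taux - 1) in
  let ty := 3 * tauy / (tauy - 1) in
  let d1 := 2 / s in
  let d2 := 2 / s * nIW ^+ 2 in
  let d3 := tx * nIW ^+ 2 in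
  let d4 := ty * nIW ^+ 2 in
  let m2 := 3 * d2 * e2 + 3 * d2 * e4 + d2 * e5
            + 18 * d2 / delta * e6 + 6 * d2 / delta * e7 in
  let m3 := 2 * nR * tx * e1 + 2 * tx * e2 + tx * e3 + d3 * e2 + d3 * e4
            + 6 * d3 * e6 / delta + e4 / (2 * kappa) in
  let m4 := 6 * nR * ty * e1 + 6 * ty * e2 + 3 * ty * e3 + 3 * d4 * e2
            + d4 * e3 + 3 * d4 * e4 + d4 * e5 + 18 * d4 / delta * e6
            + 6 * d4 / delta * e7 + e5 / (2 * kappa) in
  let B : 'M[R]_7 := mx_of_rows 7 [::
    [:: 1 - 3 / 2 * eta * mu; 3 * eta * L ^+ 2 / (mu * nR); 0; 0; 0; 0; 0];
    [:: 0; (1 + rhot ^+ 2) / 2; d1 * (eta ^+ 2 / gamma); d2 * gamma; 0;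
        6 * d2 / delta * gamma; 0];
    [:: 6 * nR * d1 * L ^+ 4 * (eta ^+ 2 / gamma);
        3 * d2 * L ^+ 2 * gamma + 6 * d1 * L ^+ 4 * (eta ^+ 2 / gamma);
        (1 + rhot ^+ 2) / 2 + 3 * d1 * L ^+ 2 * (eta ^+ 2 / gamma);
        3 * d2 * L ^+ 2 * gamma; d2 * gamma;
        18 * d2 / delta * L ^+ 2 * gamma; 6 * d2 / delta * gamma];
    [:: 2 * nR * tx * L ^+ 2 * eta ^+ 2;
        d3 * gamma ^+ 2 + 2 * tx * L ^+ 2 * eta ^+ 2; tx * eta ^+ 2;
        dx + d3 * gamma ^+ 2; 0; 6 * d3 / delta * gamma ^+ 2; 0];
    [:: 6 * nR * ty * L ^+ 4 * eta ^+ 2;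
        3 * d4 * L ^+ 2 * gamma ^+ 2 + 6 * ty * L ^+ 4 * eta ^+ 2;
        3 * ty * L ^+ 2 * eta ^+ 2 + d4 * gamma ^+ 2;
        3 * d4 * L ^+ 2 * gamma ^+ 2; dy + d4 * gamma ^+ 2;
        18 * d4 / delta * L ^+ 2 * gamma ^+ 2; 6 * d4 / delta * gamma ^+ 2];
    [:: 0; 0; 0; 2 * (1 - delta) / delta; 0; 1 - delta / 2; 0];
    [:: 0; 0; 0; 0; 2 * (1 - delta) / delta; 0; 1 - delta / 2]] in
  let X (k : nat) (w : Omega) : 'M[R]_(n, p) :=
    st_X (efcgt W f C alphax alphay gamma eta X0 Hx0 Hy0
                (fun t => xi t w) k) in
  let Omega_o (k : nat) : \bar R :=
    mean_square P (fun w => row_mean (X k w) - xs) in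
  let Omega_c (k : nat) : \bar R :=
    mean_square P (fun w => X k w - consensus_part (X k w)) in
  let r := 1 - eta * mu / 2 in
  dx < 1 -> dy < 1 ->
  3 * kappa ^+ 2 / nR * e2 <= e1 ->
  4 * d1 * d2 * e4 <= e2 ->
  24 * d1 * d2 * e6 / delta <= e2 ->
  4 * m2 / s <= e3 ->
  8 * (1 - delta) * e4 / delta ^+ 2 <= e6 ->
  8 * (1 - delta) * e5 / delta ^+ 2 <= e7 ->
  gamma <= Num.min 1 (Num.min ((1 - dx) / m3 * e4) ((1 - dy) / m4 * e5)) ->
  eta <= Num.min
    (s * e3 / (6 * kappa * (2 * nR * e1 + 2 * e2 + e3)) * (gamma / L))
    (Num.min (s * e2 / (4 * kappa * e3) * (gamma / L)) (delta / (2 * mu))) ->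
  spectral_radius B <= r /\
  (exists K : R, forall k : nat,
     (Omega_o k <= (K * r ^+ k)%:E)%E /\ (Omega_c k <= (K * r ^+ k)%:E)%E) /\
  (Omega_o @ \oo --> 0%E /\ Omega_c @ \oo --> 0%E).
Proof.
move=> nR L kappa s rhot nIW dx dy tx ty d1 d2 d3 d4 m2 m3 m4 B X Oo Oc r.
move=> hdx hdy h1 h24 h26 h3 h6 h7 hg heta'.
have L0 : 0 <= L by apply: bigmax_ge_id.
have f_lip i : lipschitz_grad L (f i).
  move=> x y; apply: le_trans (hLip i x y) _.
  by rewrite ler_wpM2r ?frob_ge0 // le_bigmax.
have xs_min : forall y, average f xs <= average f y by case: hxs.
have muL : mu <= L.
  exact: (strong_convexity_le_lipschitz hn hdiff f_lip L0 hconv hp).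
have s0 : 0 < s by rewrite subr_gt0.
have s1 : s <= 1 by rewrite lerBlDr lerDl spectral_norm_ge0.
have nR0 : 0 < nR by rewrite ltr0n.
have [dl0 dl1] := andP hdelta.
have taux0 : 0 <= taux := ltW (lt_trans ltr01 htaux).
have tauy0 : 0 <= tauy := ltW (lt_trans ltr01 htauy).
have tx0 : 0 <= tx by rewrite divr_ge0 ?mulr_ge0 ?subr_ge0 // ltW.
have ty0 : 0 <= ty by rewrite divr_ge0 ?mulr_ge0 ?subr_ge0 // ltW.
have d10 : 0 <= d1 by rewrite divr_ge0 // ltW.
have d20 : 0 <= d2 by rewrite mulr_ge0 ?sqr_ge0.
have d30 : 0 <= d3 by rewrite mulr_ge0 ?sqr_ge0.
have d40 : 0 <= d4 by rewrite mulr_ge0 ?sqr_ge0.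
move: hg; rewrite !le_min => /andP[g1 /andP[g4 g5]].
move: heta'; rewrite !le_min => /andP[eopt /andP[econs ecomp]].
have w1 := @weight_row1 R nR L mu eta e1 e2 nR0 hmu heta h1.
have w2 := weight_row2 nR0 hmu muL s0 s1 hgamma g1 heta dl0 (erefl d1)
  he1 he2 he3 eopt econs h24 h26.
have w3 := weight_row3 nR0 hmu muL s0 s1 hgamma g1 heta dl0 (erefl d1)
  he1 he2 he3 eopt h3.
have w4 := weight_row4 nR0 hmu muL s1 hgamma g1 heta dl0 d30 tx0
  he1 he2 he3 he4 he6 eopt g4.
have w5 := weight_row5 nR0 hmu muL s1 hgamma g1 heta dl0 d40 ty0
  he1 he2 he3 he4 he5 he6 he7 eopt g5.
have L2 : 0 < L ^+ 2 by rewrite exprn_gt0 // (lt_le_trans hmu).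
have w6 := weight_row6 hmu dl0 ecomp he6 h6.
(* The last row is the sixth one with the weights [L^2 e5] and [L^2 e7]. *)
have w7 : 2 * (1 - delta) / delta * (L ^+ 2 * e5) + (1 - delta / 2) * (L ^+ 2 * e7)
    <= r * (L ^+ 2 * e7).
  apply: weight_row6 => //; first exact: mulr_gt0.
  have -> : 8 * (1 - delta) * (L ^+ 2 * e5) / delta ^+ 2 =
    L ^+ 2 * (8 * (1 - delta) * e5 / delta ^+ 2) by ring.
  by rewrite ler_pM2l.
have r0 : 0 <= r.
  exact: (rate_ge0 nR0 hmu muL s0 s1 hgamma g1 heta he1 he2 he3 eopt).
have r1 : r < 1 := rate_lt1 hmu heta.
have etaL : 6 * (eta * L ^+ 2) <= mu.
  apply: le_trans (eta_sqr_le nR0 hmu muL heta he1 he2 he3 eopt) _.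
  by rewrite ler_piMl ?(ltW hmu) // mulr_ile1 // ltW.
have gam01 : 0 < gamma <= 1 by rewrite hgamma.
split.
  pose v : seq R := [:: e1; e2; L ^+ 2 * e3; e4; L ^+ 2 * e5; e6; L ^+ 2 * e7].
  apply: (@spectral_radius_le R 7 B (\col_j v`_j)) => //.
  - move=> i j; apply: mx_of_rows_ge0.
    have t0 := gradient_factor_ge0 heta hmu muL etaL.
    have dl' : 0 <= delta by exact: ltW.
    have dl'' := feedback_factor_ge0 dl1.
    have [al0 al1] := andP halphax; have [be0 be1] := andP halphay.
    have dx0 : 0 <= alphax * (1 - delta) + (1 - alphax).
      by rewrite addr_ge0 ?mulr_ge0 ?subr_ge0 // ltW.
    have dy0 : 0 <= alphay * (1 - delta) + (1 - alphay).
      by rewrite addr_ge0 ?mulr_ge0 ?subr_ge0 // ltW.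
    have rhot0 : 0 <= 1 + rhot ^+ 2 by rewrite addr_ge0 // sqr_ge0.
    have q0 : 0 <= (1 + rhot ^+ 2) / 2 by rewrite divr_ge0.
    have nR0' := ltW nR0; have mu0' := ltW hmu; have gam0' := ltW hgamma.
    have eta0' := ltW heta.
    have c1 : 0 <= eta ^+ 2 / gamma by rewrite divr_ge0 // sqr_ge0.
    have rho1 := ltW hrho; have taux1 := ltW htaux; have tauy1 := ltW htauy.
    have nIW0 : 0 <= nIW by exact: spectral_norm_ge0.
    rewrite /= !lexx !andbT; do ?[apply/andP; split] => //;
      by rewrite ?addr_ge0 ?mulr_ge0 ?invr_ge0 ?mulr_ge0 ?exprn_ge0 ?subr_ge0 ?ler0n.
  - case=> [[|[|[|[|[|[|[|//]]]]]]] ?]; rewrite mxE //=; exact: mulr_gt0.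
  - move=> i; rewrite mx_of_rows_mul !big_ord_recl big_ord0 mxE.
    case: i => [[|[|[|[|[|[|[|//]]]]]]] ?] /=;
      rewrite /bump /= ?mul0r ?add0r ?addr0 ?addrA.
    + exact: w1.
    + exact: w2.
    + exact: w3.
    + exact: w4.
    + exact: w5.
    + exact: w6.
    + exact: w7.
(* The initial state does not depend on the seeds, so the initial errors are
   constants, and [K] only has to dominate their ratios to the weights. *)
pose st0 := efcgt W f C alphax alphay gamma eta X0 Hx0 Hy0 (fun=> point) 0.
pose v3 := L ^+ 2 * e3; pose v5 := L ^+ 2 * e5; pose v7 := L ^+ 2 * e7.
have v30 : 0 < v3 by exact: mulr_gt0.
have v50 : 0 < v5 by exact: mulr_gt0.
have v70 : 0 < v7 by exact: mulr_gt0.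
have [K K0 leK] := common_bound [:: optimization_error xs st0 / e1;
  consensus_error st0 / e2; tracking_error st0 / v3; compression_error_x st0 / e4;
  compression_error_y st0 / v5; feedback_error_x st0 / e6; feedback_error_y st0 / v7].
have init (a e : R) : 0 <= a -> 0 < e -> a / e <= K -> mean_le P (fun=> a) (K * r ^+ 0 * e).
  by move=> a0 ep h; apply: mean_le_cst => //; rewrite expr0 mulr1 -ler_pdivrMr.
have main k : mean_errors_le xi W f xs C alphax alphay gamma eta X0 Hx0 Hy0 k
    (K * r ^+ k * e1) (K * r ^+ k * e2) (K * r ^+ k * v3) (K * r ^+ k * e4)
    (K * r ^+ k * v5) (K * r ^+ k * e6) (K * r ^+ k * v7).
  elim: k => [|k IHk].
    split; split.
    - by apply: (init (optimization_error xs st0) e1); rewrite ?sqn_ge0 // leK // !inE eqxx ?orbT.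
    - by apply: (init (consensus_error st0) e2); rewrite ?sqn_ge0 // leK // !inE eqxx ?orbT.
    - by apply: (init (tracking_error st0) v3); rewrite ?sqn_ge0 // leK // !inE eqxx ?orbT.
    - by apply: (init (compression_error_x st0) e4); rewrite ?sqn_ge0 // leK // !inE eqxx ?orbT.
    - by apply: (init (compression_error_y st0) v5); rewrite ?sqn_ge0 // leK // !inE eqxx ?orbT.
    - by apply: (init (feedback_error_x st0) e6); rewrite ?sqn_ge0 // leK // !inE eqxx ?orbT.
    - by apply: (init (feedback_error_y st0) v7); rewrite ?sqn_ge0 // leK // !inE eqxx ?orbT.
  (* The right-hand sides of the one-step inequality are homogeneous, so the row
     inequalities for the weights apply after factoring out [T]. *)
  set T := K * r ^+ k in IHk *.
  have T0 : 0 <= T by rewrite mulr_ge0 // exprn_ge0.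
  have up a e : a <= r * e -> T * a <= K * r ^+ k.+1 * e.
    have -> : K * r ^+ k.+1 * e = T * (r * e) by rewrite exprS /T; ring.
    exact: ler_wpM2l.
  have [[b1 b2 b3] [b4 b5] [b6 b7]] := mean_errors_step hn hxi_law hxi_indep hW hdiff
    f_lip L0 hconv hmu xs_min hdelta hCm hC hrho gam01 heta halphax halphay htaux htauy
    muL etaL IHk.
  by split; split; [apply: mean_le_mono b1 _|apply: mean_le_mono b2 _
    |apply: mean_le_mono b3 _|apply: mean_le_mono b4 _|apply: mean_le_mono b5 _
    |apply: mean_le_mono b6 _|apply: mean_le_mono b7 _];
   [apply: le_trans (up _ _ w1)|apply: le_trans (up _ _ w2)|apply: le_trans (up _ _ w3)
   |apply: le_trans (up _ _ w4)|apply: le_trans (up _ _ w5)|apply: le_trans (up _ _ w6)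
   |apply: le_trans (up _ _ w7)]; apply: le_of_eq;
   rewrite /v3 /v5 /v7 /d4 /d3 /d2 /d1 /tx /ty /dx /dy /rhot /s /nIW /nR; ring.
have bound k : (Oo k <= (K * (e1 + e2) * r ^+ k)%:E)%E /\ (Oc k <= (K * (e1 + e2) * r ^+ k)%:E)%E.
  have [[[_ _ b1] [_ _ b2] _] _ _] := main k.
  have T0 : 0 <= K * r ^+ k by rewrite mulr_ge0 // exprn_ge0.
  rewrite /Oo /Oc /mean_square; split.
    under eq_fun do rewrite frob_sqr.
    apply: le_trans b1 _; rewrite lee_fin [leRHS]mulrAC.
    by rewrite ler_wpM2l // lerDl ltW.
  under eq_fun do rewrite frob_sqr.
  apply: le_trans b2 _; rewrite lee_fin [leRHS]mulrAC.
  by rewrite ler_wpM2l // lerDr ltW.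
split; first by exists (K * (e1 + e2)).
split; apply: (squeeze_geometric r0 r1) => k; try exact: (bound k).1; try exact: (bound k).2.
  by apply: expectation_ge0 => w; exact: sqr_ge0.
by apply: expectation_ge0 => w; exact: sqr_ge0.
Qed.
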